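(* Let $k,m\in\mathbb{Z}$ and let $n$ be a positive integer. (1) If $f\in J_{k,m}^{\int}(\Gamma(1))$, then $f|_{k,m}\mathcal{V}_n^{\infty}\in J_{k,mn}^{\int}(\Gamma(1))$, where $$(f|_{k,m}\mathcal{V}_n^\infty)(\tau,z)=n^{k-1}\sum_{\substack{ad=n,\ a>0\\ b \,(\mathrm{mod}\, d)}} d^{-k} f\Big(\frac{a\tau+b}{d},az\Big).$$ (2) Let $f\in J_{k,m}^{\int}(\Gamma(1))$, and write $f|_{k,m}T=f+P_T$ and $(f|_{k,m}\mathcal{V}_n^\infty)|_{k,mn}T=(f|_{k,m}\mathcal{V}_n^\infty)+\hat P_T$. Then $$\hat P_T(\tau,z)=n^{\frac{k}{2}-1}\,\big(P_T|_{k,m}\tilde{\mathcal{V}}_n\big)(\tau,\sqrt{n}\,z),$$ where $\tilde{\mathcal V}_n$ is the formal sum (over integers $a,b,c,d$ satisfying the indicated conditions) $$\tilde{\mathcal{V}}_{n}=\sum_{\substack{ad-bc=n\\ a>c>0,\ d>-b>0}}\left\{\left[\begin{pmatrix}a&b\\c&d\end{pmatrix},(0,0)\right]+\left[\begin{pmatrix}a&-b\\-c&d\end{pmatrix},(0,0)\right]\right\}+\sum_{\substack{ad=n\\ -\frac12 d<b\le \frac12 d}}\left[\begin{pmatrix}a&b\\0&d\end{pmatrix},(0,0)\right]+\sum_{\substack{ad=n\\ -\frac12 a<c\le\frac12 a,\ c\neq 0}}\left[\begin{pmatrix}a&0\\c&d\end{pmatrix},(0,0)\right].$$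
   Context: Notation: $\mathcal{H}$ is the complex upper half plane, $\tau=u+iv\in\mathcal H$, $z=x+iy\in\mathbb{C}$ with $u,v,x,y\in\mathbb{R}$; $\Gamma(1)=SL_2(\mathbb{Z})$. Full Jacobi group: $\Gamma(1)^J=\Gamma(1)\ltimes\mathbb{Z}^2=\{[M,(\lambda,\mu)] : M\in\Gamma(1),\ \lambda,\mu\in\mathbb{Z}\}$ with group law $[M_1,(\lambda_1,\mu_1)][M_2,(\lambda_2,\mu_2)]=[M_1M_2,(\lambda_1,\mu_1)M_2+(\lambda_2,\mu_2)]$. Put $T=\left[\begin{pmatrix}0&-1\\1&0\end{pmatrix},(1,0)\right]$. Slash operator: for $\gamma=\left[\begin{pmatrix}a&b\\c&d\end{pmatrix},(\lambda,\mu)\right]$ with real matrix of determinant $1$, $\lambda,\mu\in\mathbb{R}$, and $f:\mathcal{H}\times\mathbb{C}\to\mathbb{C}$, $$(f|_{k,m}\gamma)(\tau,z)=(c\tau+d)^{-k}e^{2\pi i m\left(-\frac{c(z+\lambda\tau+\mu)^2}{c\tau+d}+\lambda^2\tau+2\lambda z+\lambda\mu\right)}f\Big(\frac{a\tau+b}{c\tau+d},\frac{z+\lambda\tau+\mu}{c\tau+d}\Big).$$ If instead $ad-bc=\ell>0$, then $f|_{k,m}\left[\begin{pmatrix}a&b\\c&d\end{pmatrix},(X,Y)\right]:=f|_{k,m}\left[\frac{1}{\sqrt{\ell}}\begin{pmatrix}a&b\\c&d\end{pmatrix},(X,Y)\right]$. Formal integral linear combinations act by linearity: $f|_{k,m}\sum_i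 n_i\gamma_i=\sum_i n_i\, f|_{k,m}\gamma_i$. Let $\mathcal{P}_m$ be the set of holomorphic $g:\mathcal{H}\times\mathbb{C}\to\mathbb{C}$ with $|g(\tau,z)|<K(|\tau|^\rho+v^{-\sigma})e^{2\pi m y^2/v}$ for some $K,\rho,\sigma>0$. Jacobi integrals: $J_{k,m}^{\int}(\Gamma(1))$ is the complex vector space of Jacobi integrals of weight $k$ and index $m$, i.e. real analytic functions $f:\mathcal{H}\times\mathbb{C}\to\mathbb{C}$, periodic in both variables ($f(\tau+1,z)=f(\tau,z+1)=f(\tau,z)$), such that (i) for every $\gamma\in\Gamma(1)^J$, $f|_{k,m}\gamma=f+P_\gamma$ with $P_\gamma\in\mathcal{P}_m$ (the functions $P_\gamma$ are the period functions of $f$); (ii) $|f(\tau,z)|\,v^{-k/2}e^{-2\pi m y^2/v}\to 0$ as $v,y\to\infty$.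
   Formalization: Part (2) is proved under the added hypothesis f|_{k,m}[-I,(0,0)] = f; without it (2) fails, e.g. for m=1, n=3, f(τ,z)=e^{2πi(τ+z)}. Part (1) is as stated. *)

(* Defs.v *)
From HB Require Import structures.
From mathcomp Require Export all_boot all_order all_algebra.
From mathcomp Require Export all_classical all_reals all_analysis.
From mathcomp Require Export complex.

Set Implicit Arguments.
Unset Strict Implicit.
Unset Printing Implicit Defensive.

Import Order.TTheory GRing.Theory Num.Theory numFieldNormedType.Exports.
Local Open Scope classical_set_scope.
Local Open Scope ring_scope.
Local Open Scope complex_scope.

(* Functions on H x C are represented by total functions C -> C -> C; every
   condition below only looks at their values at (tau, z) with tau in H.
   [complex.Re] and [complex.Im] are R-valued, [normc] is the R-valued modulus,
   and R[i]^o is R[i] with its norm topology, as a normed space over itself. *)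

Notation normc := ComplexField.Normc.normc.

Definition upper_half_plane (R : realType) : set R[i] :=
  [set tau | 0 < complex.Im tau].

Definition cexp (R : realType) (w : R[i]) : R[i] :=
  (expR (complex.Re w))%:C * (cos (complex.Im w) +i* sin (complex.Im w)).

(* [(a, b; c, d), (lambda, mu)] *)
Definition jacobi_elt (R : realType) : Type := ('M[R]_2 * 'rV[R]_2)%type.

Definition mx22 (A : Type) (a b c d : A) : 'M[A]_2 :=
  \matrix_(i < 2, j < 2)
    if i == 0 then (if j == 0 then a else b) else (if j == 0 then c else d).

Definition rv2 (A : Type) (x y : A) : 'rV[A]_2 :=
  \row_(j < 2) if j == 0 then x else y.

Definition int_elt (R : realType) (M : 'M[int]_2) (X : 'rV[int]_2) :
    jacobi_elt R :=
  (map_mx (fun x : int => x%:~R) M, map_mx (fun x : int => x%:~R) X).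

Definition full_jacobi_group (R : realType) : set (jacobi_elt R) :=
  [set g | exists (M : 'M[int]_2) (X : 'rV[int]_2),
             \det M = 1 /\ g = int_elt R M X].

Definition eltT (R : realType) : jacobi_elt R :=
  int_elt R (mx22 0 (-1) 1 0) (rv2 1 0).

(* [-I, (0, 0)], which acts by (f|[-I, (0, 0)])(tau, z) = (-1)^k f(tau, -z). *)
Definition eltN1 (R : realType) : jacobi_elt R := int_elt R (- 1%:M) 0.

(* The slash operator for matrices of determinant 1. *)
Definition slash1 (R : realType) (k m : int) (g : jacobi_elt R)
    (f : R[i] -> R[i] -> R[i]) (tau z : R[i]) : R[i] :=
  let a := (g.1 0 0)%:C in let b := (g.1 0 1)%:C in
  let c := (g.1 1 0)%:C in let d := (g.1 1 1)%:C in
  let la := (g.2 0 0)%:C in let mu := (g.2 0 1)%:C in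
  let j := c * tau + d in
  let w := z + la * tau + mu in
  j ^ (- k) *
  cexp (2 * pi%:C * 'i%C * m%:~R *
        (- (c * w ^+ 2 / j) + la ^+ 2 * tau + 2 * la * z + la * mu)) *
  f ((a * tau + b) / j) (w / j).

(* The slash operator for matrices of determinant l > 0: only the matrix is
   divided by the square root of l, not the vector. *)
Definition slash (R : realType) (k m : int) (g : jacobi_elt R)
    (f : R[i] -> R[i] -> R[i]) : R[i] -> R[i] -> R[i] :=
  slash1 k m ((Num.sqrt (\det g.1))^-1 *: g.1, g.2) f.

(* The period function P_g, defined by f|g = f + P_g. *)
Definition period_function (R : realType) (k m : int)
    (f : R[i] -> R[i] -> R[i]) (g : jacobi_elt R) (tau z : R[i]) : R[i] :=
  slash1 k m g f tau z - f tau z.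

Definition holomorphic_HC (R : realType) (g : R[i] -> R[i] -> R[i]) : Prop :=
  forall tau z : R[i], upper_half_plane tau ->
    differentiable
      ((fun p => g p.1 p.2) : (R[i]^o * R[i]^o)%type -> R[i]^o)
      ((tau, z) : (R[i]^o * R[i]^o)%type).

(* The set P_m. *)
Definition period_space (R : realType) (m : int)
    (g : R[i] -> R[i] -> R[i]) : Prop :=
  holomorphic_HC g /\
  exists K rho sigma : R, [/\ 0 < K, 0 < rho, 0 < sigma &
    forall tau z : R[i], upper_half_plane tau ->
      let v := complex.Im tau in let y := complex.Im z in
      normc (g tau z) <
        K * (normc tau `^ rho + v `^ (- sigma)) *
        expR (2 * pi * m%:~R * y ^+ 2 / v)].

(* Near p, F is the sum of an absolutely convergent power series in d real
   variables; the N-th partial sum runs over the multi-indices in {0,..,N-1}^d. *)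
Definition real_analytic_at (R : realType) (d : nat)
    (F : 'rV[R]_d -> R[i]) (p : 'rV[R]_d) : Prop :=
  exists (r : R) (coef : {ffun 'I_d -> nat} -> R[i]), 0 < r /\
    forall h : 'rV[R]_d, (forall i, `|h 0 i| < r) ->
      (exists B : R, forall N : nat,
         \sum_(al : {ffun 'I_d -> 'I_N})
            normc (coef [ffun i => al i : nat]) * \prod_i `|h 0 i| ^+ al i
         <= B) /\
      (fun N : nat => (\sum_(al : {ffun 'I_d -> 'I_N})
            coef [ffun i => al i : nat] * (\prod_i h 0 i ^+ al i)%:C) : R[i]^o)
        @ \oo --> (F (p + h) : R[i]^o).

(* A function on H x C in the real coordinates (u, v, x, y), where
   tau = u + iv and z = x + iy. *)
Definition real_coords (R : realType) (f : R[i] -> R[i] -> R[i])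
    (p : 'rV[R]_4) : R[i] :=
  f (p 0 (inord 0) +i* p 0 (inord 1)) (p 0 (inord 2) +i* p 0 (inord 3)).

Definition real_analytic_HC (R : realType) (f : R[i] -> R[i] -> R[i]) : Prop :=
  forall p : 'rV[R]_4, 0 < p 0 (inord 1) ->
    real_analytic_at (real_coords f) p.

Definition jacobi_integral (R : realType) (k m : int)
    (f : R[i] -> R[i] -> R[i]) : Prop :=
  [/\ real_analytic_HC f,
      forall tau z : R[i], upper_half_plane tau ->
        f (tau + 1) z = f tau z /\ f tau (z + 1) = f tau z,
      forall g : jacobi_elt R, full_jacobi_group g ->
        period_space m (period_function k m f g)
    & forall eps : R, 0 < eps -> exists A : R,
        forall tau z : R[i], upper_half_plane tau ->
          let v := complex.Im tau in let y := complex.Im z in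
          A < v -> A < y ->
          normc (f tau z) * v `^ (- k%:~R / 2) *
            expR (- (2 * pi * m%:~R * y ^+ 2 / v)) < eps].

(* The representatives 0, ..., d-1 are used for b mod d; for f periodic in tau
   the choice is irrelevant. *)
Definition Vinfty (R : realType) (k : int) (n : nat)
    (f : R[i] -> R[i] -> R[i]) (tau z : R[i]) : R[i] :=
  n%:R ^ (k - 1) *
  \sum_(d <- divisors n) \sum_(0 <= b < d)
    d%:R ^ (- k) * f (((n %/ d)%N%:R * tau + b%:R) / d%:R) ((n %/ d)%N%:R * z).

(* The index sets of the three sums in the formal sum V~_n; the inequalities
   force a, d > 0, so the sets are finite. *)
Definition Vtilde_set1 (n : nat) : set 'M[int]_2 :=
  [set M | [/\ M 0 0 * M 1 1 - M 0 1 * M 1 0 = n%:Z,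
               M 1 0 < M 0 0, 0 < M 1 0, - M 0 1 < M 1 1 & 0 < - M 0 1]].

Definition Vtilde_set2 (n : nat) : set 'M[int]_2 :=
  [set M | [/\ M 1 0 = 0, M 0 0 * M 1 1 = n%:Z,
               - M 1 1 < 2 * M 0 1 & 2 * M 0 1 <= M 1 1]].

Definition Vtilde_set3 (n : nat) : set 'M[int]_2 :=
  [set M | [/\ M 0 1 = 0, M 0 0 * M 1 1 = n%:Z,
               - M 0 0 < 2 * M 1 0, 2 * M 1 0 <= M 0 0 & M 1 0 != 0]].

(* f|V~_n, the formal sum V~_n acting by linearity. *)
Definition slash_Vtilde (R : realType) (k m : int) (n : nat)
    (f : R[i] -> R[i] -> R[i]) (tau z : R[i]) : R[i] :=
  \sum_(M \in Vtilde_set1 n)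
     (slash k m (int_elt R M 0) f tau z +
      slash k m
        (int_elt R (mx22 (M 0 0) (- M 0 1) (- M 1 0) (M 1 1)) 0) f tau z) +
  \sum_(M \in Vtilde_set2 n) slash k m (int_elt R M 0) f tau z +
  \sum_(M \in Vtilde_set3 n) slash k m (int_elt R M 0) f tau z.

(* The relation between the T-period function of f|V_n^oo and the one of f
   needs f|[-I, (0, 0)] = f, that is, P_{[-I, (0, 0)]} = 0: the matrices in the
   two sides cancel modulo +-1 and left multiplication by (1, 1; 0, 1), but not
   modulo the latter alone.  For n = 3, the difference of the two sides is
     3^(k/2 - 1) ((f - f|[-I, (0, 0)])|[(0, -3; 1, -1), (0, 0)])(tau, sqrt 3 z)
   up to sign, so the condition is also necessary; and it does not hold for all
   Jacobi integrals: f(tau, z) = e^(2 pi i (tau + z)) is one of index 1 and of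
   any weight k, and f|[-I, (0, 0)] != f. *)
Definition N1_invariant (R : realType) (k m : int)
    (f : R[i] -> R[i] -> R[i]) : Prop :=
  forall tau z : R[i], upper_half_plane tau ->
    slash1 k m (eltN1 R) f tau z = f tau z.

(* Main.v *)
(* A matrix [A] of determinant [n] acts by [|_k [A / sqrt n, (0, 0)]]; after the
   substitution [z -> sqrt n * z] the square roots disappear, and
   [f|V_n^oo = n^(k-1) sum_A f|A] over the representatives [A = (n/d, b; 0, d)] of
   SL_2(Z) \ M_n, where M_n is the set of integral matrices of determinant [n].
   (1) For [g = [M, X]] write [A M = N A'] with [N] in SL_2(Z) and [A'] again a
   representative; then [f|A|g = f|[N, X adj A']|A'], and [A -> A'] permutes the
   representatives, so that the period function of [f|V_n^oo] for [g] is the sum of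
   the [P_[N, X adj A']|A'].  The growth and regularity conditions pass through the
   substitutions [(tau, z) -> ((a tau + b) / d, a z)].
   (2) As [f] is periodic in [z], [T] acts on it like [[S, (0, 0)]], and [f|A]
   depends on [A] only up to sign and left multiplication by [(1, 1; 0, 1)].  The
   claim becomes the identity [V_n^oo (S - 1) = (S - 1) V~_n] for such classes.  The
   terms left after the obvious cancellations have both entries of the bottom row
   nonzero, and they are matched by one Euclidean division. *)
Require Import Defs.
From mathcomp Require Import ring lra zify.
Import Order.TTheory GRing.Theory Num.Theory numFieldNormedType.Exports.
Local Open Scope classical_set_scope.
Local Open Scope ring_scope.
Local Open Scope complex_scope.

Set Implicit Arguments.
Unset Strict Implicit.
Unset Printing Implicit Defensive.

(** * The exponential and the upper half plane *)

Lemma cexpD (R : realType) (x y : R[i]) : cexp (x + y) = cexp x * cexp y.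
Proof.
case: x => a b; case: y => c d; rewrite /cexp /= expRD cosD sinD.
by apply/eqP; rewrite eq_complex /=; apply/andP; split; apply/eqP; ring.
Qed.

Lemma cexp0 (R : realType) : cexp (0 : R[i]) = 1.
Proof.
rewrite /cexp /= expR0 cos0 sin0.
by apply/eqP; rewrite eq_complex /= ; apply/andP; split; apply/eqP; ring.
Qed.

Lemma affineE (R : realType) (a b u v : R) :
  a%:C * (u +i* v) + b%:C = (a * u + b) +i* (a * v).
Proof.
by apply/eqP; rewrite eq_complex /=; apply/andP; split; apply/eqP; ring.
Qed.

Lemma affine_uhp_neq0 (R : realType) (c d : R) (tau : R[i]) :
  upper_half_plane tau -> (c, d) != (0, 0) -> c%:C * tau + d%:C != 0.
Proof.
case: tau => u v; rewrite /upper_half_plane /= affineE => v0.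
apply: contra; rewrite eq_complex /= mulf_eq0 (gt_eqF v0) orbF.
by move=> /andP[/[swap]/eqP->]; rewrite mul0r add0r => /eqP->.
Qed.

Lemma moebius_uhp (R : realType) (a b c d : R) (tau : R[i]) :
  0 < a * d - b * c -> upper_half_plane tau ->
  upper_half_plane ((a%:C * tau + b%:C) / (c%:C * tau + d%:C)).
Proof.
move=> D tH.
have cd0 : (c, d) != (0, 0).
  by apply: contraTneq D => -[-> ->]; rewrite !mulr0 subrr ltxx.
have := affine_uhp_neq0 tH cd0.
case: tau tH => u v; rewrite /upper_half_plane /= => v0.
rewrite affineE eq_complex /= => j0.
rewrite [ltRHS](_ : _ =
   (a * d - b * c) * v / ((c * u + d) ^+ 2 + (c * v) ^+ 2)); last first.
  by rewrite !mul0r !addr0 !subr0; ring.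
rewrite divr_gt0 ?mulr_gt0//.
rewrite lt_neqAle addr_ge0 ?sqr_ge0// andbT eq_sym paddr_eq0 ?sqr_ge0//.
by rewrite !sqrf_eq0.
Qed.

(** The expansion of [g] at [x] is also one of [f], and the differential is unique. This transfers
    holomorphy between total functions that agree only over the open half plane. *)
Lemma near_differentiable (K : numFieldType) (V W : normedModType K)
    (f g : V -> W) (x : V) :
  {near nbhs x, f =1 g} -> differentiable g x -> differentiable f x.
Proof.
move=> fg dg.
have fxg : f x = g x by exact: (nbhs_singleton fg).
have [dgc dgo] := (diff_locallyP _ _).1 dg.
have E : f \o shift x = cst (f x) + 'd g x +o_ 0 id.
  apply/eqaddoP => _/posnumP[e].
  have /eqaddoP/(_ e%:num (gt0 e)) := dgo; rewrite -fxg => dge.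
  have fg0 : \forall h \near (0 : V), f (h + x) = g (h + x).
    by have /nbhs0P := fg; apply: filterS => h; rewrite addrC.
  near=> h.
  rewrite /= !fctE/= (near fg0 h)//.
  by near: h.
by apply/diff_locallyP; rewrite (diff_unique dgc E).
Unshelve. all: by end_near. Qed.

(** * Slash operators without square roots *)

(* [jslash k m 1] is the slash operator of index [m]; for a matrix of
   determinant [l], [jslash k (m * l) l] is the slash operator of index [m]
   after the change of variable [z -> sqrt l * z], which clears the square
   roots. *)
Definition jslash (R : realType) (k : int) (m l a b c d la mu : R[i])
    (f : R[i] -> R[i] -> R[i]) (tau z : R[i]) : R[i] :=
  let j := c * tau + d in
  let w := z + la * tau + mu in
  j ^ (- k) *
  cexp (2 * pi%:C * 'i%C * m *
        (- (c * w ^+ 2 / j) + la ^+ 2 * tau + 2 * la * z + la * mu)) *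
  f ((a * tau + b) / j) (l * w / j).

(** The weight factors multiply by the cocycle relation for [c * tau + d], and the exponents add up
    because the outer matrix has determinant 1. The inner vector is zero, so the outer one survives
    unchanged. *)
Lemma jslash_comp_left (R : realType) (k : int) (m l a b c d la mu a' b' c' d' : R[i])
    f (tau z : R[i]) :
  c * tau + d != 0 -> c' * ((a * tau + b) / (c * tau + d)) + d' != 0 ->
  a * d - b * c = 1 ->
  jslash k m 1 a b c d la mu (jslash k m l a' b' c' d' 0 0 f) tau z =
  jslash k m l (a' * a + b' * c) (a' * b + b' * d) (c' * a + d' * c)
    (c' * b + d' * d) la mu f tau z.
Proof.
move=> j0 j1 D; rewrite /jslash.
have j2 : c' * (a * tau + b) + d' * (c * tau + d) != 0.
  apply: contra j1 => /eqP E; apply/eqP/(mulIf j0).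
  by rewrite mul0r -E; field.
have jE : (c' * a + d' * c) * tau + (c' * b + d' * d) =
  (c' * ((a * tau + b) / (c * tau + d)) + d') * (c * tau + d) by field.
have mulACA x y x' y' t : x * y * (x' * y' * t) = x' * x * (y * y') * t :> R[i].
  by ring.
rewrite [in RHS]jE expfzMl [LHS]mulACA -cexpD -mulrDr.
congr (_ * cexp (_ * _) * _); last by congr (f _ _); field; rewrite ?j0 ?j2.
(* These are the coefficients of [w ^+ 2] in the exponents. Writing [c'] as [c' * (a * d - b * c)]
   makes their sum a rational identity. *)
have K : c / (c * tau + d) + c' / ((c * tau + d) ^+ 2 *
    (c' * ((a * tau + b) / (c * tau + d)) + d')) =
    (c' * a + d' * c) / ((c' * ((a * tau + b) / (c * tau + d)) + d') *
    (c * tau + d)).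
  transitivity (c / (c * tau + d) + c' * (a * d - b * c) / ((c * tau + d) ^+ 2 *
    (c' * ((a * tau + b) / (c * tau + d)) + d'))); first by rewrite D mulr1.
  by field; rewrite j0 j2.
have -> x y : x * y ^+ 2 / ((c' * ((a * tau + b) / (c * tau + d)) + d') *
   (c * tau + d)) = y ^+ 2 * (x / ((c' * ((a * tau + b) / (c * tau + d)) + d') *
   (c * tau + d))) by rewrite -mulrA mulrCA.
by rewrite -K; field; rewrite j0 j2.
Qed.

(** Now the matrix [A] of determinant [l] is outside. As it sends [z] to [l * z / j], the inner
    vector [X] becomes [X A / l], and the outer index [m * l] matches the inner index [m]. *)
Lemma jslash_comp_right (R : realType) (k : int) (m l a b c d la mu a' b' c' d' : R[i])
    f (tau z : R[i]) :
  c * tau + d != 0 -> c' * ((a * tau + b) / (c * tau + d)) + d' != 0 ->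
  a * d - b * c = l -> l != 0 ->
  jslash k (m * l) l a b c d 0 0 (jslash k m 1 a' b' c' d' la mu f) tau z =
  jslash k (m * l) l (a' * a + b' * c) (a' * b + b' * d) (c' * a + d' * c)
    (c' * b + d' * d) ((la * a + mu * c) / l) ((la * b + mu * d) / l) f tau z.
Proof.
move=> j0 j1 D l0; rewrite /jslash.
have j2 : c' * (a * tau + b) + d' * (c * tau + d) != 0.
  apply: contra j1 => /eqP E; apply/eqP/(mulIf j0).
  by rewrite mul0r -E; field.
have jE : (c' * a + d' * c) * tau + (c' * b + d' * d) =
  (c' * ((a * tau + b) / (c * tau + d)) + d') * (c * tau + d) by field.
have mulACA x y x' y' t : x * y * (x' * y' * t) = x' * x * (y * y') * t :> R[i].
  by ring.
have wE : (l * (z + 0 * tau + 0) / (c * tau + d) +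
    la * ((a * tau + b) / (c * tau + d)) + mu) =
  l * (z + (la * a + mu * c) / l * tau + (la * b + mu * d) / l) /
  (c * tau + d) by field; rewrite j0 l0.
rewrite wE {wE} [in RHS]jE expfzMl [LHS]mulACA -cexpD.
congr (_ * cexp _ * _); last by congr (f _ _); field; rewrite ?j0 ?j2 ?l0.
rewrite -D in l0 *.
by field; rewrite j0 j2 l0.
Qed.

Lemma det_mx22 (A : comNzRingType) (M : 'M[A]_2) :
  \det M = M 0 0 * M 1 1 - M 0 1 * M 1 0.
Proof.
rewrite (expand_det_row _ 0) !big_ord_recl big_ord0 addr0 /cofactor /=.
rewrite !det_mx11 !mxE /= !addn0 addn1 expr0 expr1 mul1r mulN1r mulrN.
by congr (M _ _ * M _ _ - M _ _ * M _ _); apply: val_inj.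
Qed.

Lemma mulmx22E (A : pzSemiRingType) (m : nat) (M : 'M[A]_(m, 2)) (N : 'M[A]_2) i j :
  (M *m N) i j = M i 0 * N 0 j + M i 1 * N 1 j.
Proof.
rewrite mxE !big_ord_recl big_ord0 addr0.
by congr (_ + M i _ * N _ j); apply: val_inj.
Qed.

Definition int_jslash (R : realType) (k : int) (m l : R[i])
    (M : 'M[int]_2) (X : 'rV[int]_2) : (R[i] -> R[i] -> R[i]) -> R[i] -> R[i] -> R[i] :=
  jslash k m l (M 0 0)%:~R (M 0 1)%:~R (M 1 0)%:~R (M 1 1)%:~R
    (X 0 0)%:~R (X 0 1)%:~R.

Lemma real_complex_int (R : realType) (x : int) : (x%:~R : R)%:C = x%:~R :> R[i].
Proof. by rewrite rmorph_int. Qed.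

Lemma slash1_int_elt (R : realType) (k m : int) M X f (tau z : R[i]) :
  slash1 k m (int_elt R M X) f tau z = int_jslash k m%:~R 1 M X f tau z.
Proof. by rewrite /slash1 /int_jslash /jslash /= !mxE !real_complex_int mul1r. Qed.

Lemma int_affine_uhp_neq0 (R : realType) (M : 'M[int]_2) (tau : R[i]) :
  upper_half_plane tau -> 0 < \det M -> (M 1 0)%:~R * tau + (M 1 1)%:~R != 0.
Proof.
move=> tH dM; rewrite -!real_complex_int; apply: affine_uhp_neq0 => //.
apply: contraTneq dM => -[] /eqP + /eqP; rewrite !intr_eq0 det_mx22.
by move=> /eqP-> /eqP->; rewrite !mulr0 subrr ltxx.
Qed.

Lemma int_moebius_uhp (R : realType) (M : 'M[int]_2) (tau : R[i]) :
  upper_half_plane tau -> 0 < \det M ->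
  upper_half_plane (((M 0 0)%:~R * tau + (M 0 1)%:~R) /
                    ((M 1 0)%:~R * tau + (M 1 1)%:~R)).
Proof.
move=> tH dM; rewrite -!real_complex_int; apply: moebius_uhp => //.
by rewrite -!intrM -intrB -det_mx22 ltr0z.
Qed.

Lemma eq_int_jslash (R : realType) (k : int) (m l : R[i]) M X f g (tau z : R[i]) :
  upper_half_plane tau -> 0 < \det M ->
  (forall t w, upper_half_plane t -> f t w = g t w) ->
  int_jslash k m l M X f tau z = int_jslash k m l M X g tau z.
Proof.
move=> tH dM fg; rewrite /int_jslash /jslash fg//.
exact: int_moebius_uhp.
Qed.

Lemma int_jslash_comp_left (R : realType) (k : int) (m l : R[i]) M X A f (tau z : R[i]) :
  upper_half_plane tau -> \det M = 1 -> 0 < \det A ->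
  int_jslash k m 1 M X (int_jslash k m l A 0 f) tau z =
  int_jslash k m l (A *m M) X f tau z.
Proof.
move=> tH dM dA; rewrite /int_jslash !mulmx22E !mxE !rmorphD !rmorphM /=.
apply: jslash_comp_left.
- by apply: int_affine_uhp_neq0; rewrite ?dM.
- by apply: int_affine_uhp_neq0; rewrite ?dM//; apply: int_moebius_uhp; rewrite ?dM.
- by rewrite -!intrM -intrB -det_mx22 dM.
Qed.

(** The hypothesis on [X *m A] asks that the transported vector [X A / n] be integral; for a
    prescribed [Y] it is met by [X = Y adj A]. *)
Lemma int_jslash_comp_right (R : realType) (k : int) (m : R[i]) (n : int)
    M X A Y f (tau z : R[i]) :
  upper_half_plane tau -> \det M = 1 -> 0 < n -> \det A = n -> X *m A = n *: Y ->
  int_jslash k (m * n%:~R) n%:~R A 0 (int_jslash k m 1 M X f) tau z =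
  int_jslash k (m * n%:~R) n%:~R (M *m A) Y f tau z.
Proof.
move=> tH dM n0 dA XA; rewrite /int_jslash !mulmx22E.
have nC : n%:~R != 0 :> R[i] by rewrite intr_eq0 gt_eqF.
have YE j :
    (Y 0 j)%:~R = ((X 0 0)%:~R * (A 0 j)%:~R + (X 0 1)%:~R * (A 1 j)%:~R) / n%:~R :> R[i].
  apply/(canRL (mulfK nC)).
  by rewrite -!intrM -intrD -mulmx22E XA mxE mulrC.
rewrite !YE ![(0 : 'rV__) _ _]mxE !rmorphD !rmorphM /=.
apply: jslash_comp_right => //.
- by apply: int_affine_uhp_neq0; rewrite ?dA.
- by apply: int_affine_uhp_neq0; rewrite ?dM//; apply: int_moebius_uhp; rewrite ?dA.
- by rewrite -!intrM -intrB -det_mx22 dA.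
Qed.

Lemma int_jslash_trig (R : realType) (k : int) (m l : R[i]) (A : 'M[int]_2) f
    (tau z : R[i]) :
  A 1 0 = 0 ->
  int_jslash k m l A 0 f tau z = (A 1 1)%:~R ^ (- k) *
    f (((A 0 0)%:~R * tau + (A 0 1)%:~R) / (A 1 1)%:~R) (l * z / (A 1 1)%:~R).
Proof.
move=> A0; rewrite /int_jslash /jslash A0 !mxE !mul0r !mulr0 !mul0r !add0r !addr0.
by rewrite oppr0 expr2 !mul0r addr0 !mulr0 cexp0 mulr1.
Qed.

(** Dividing the matrix by $\sqrt n$ contributes $n^{k/2}$ through the weight factor. After
    $z\mapsto\sqrt n\,z$ the roots in the exponent and in the second argument pair up to factors
    $n$. *)
Lemma slash_int_elt (R : realType) (k m : int) (n : nat) (M : 'M[int]_2) f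
    (tau z : R[i]) :
  (0 < n)%N -> \det M = n%:Z -> upper_half_plane tau ->
  slash k m (int_elt R M 0) f tau ((Num.sqrt n%:R)%:C * z) =
  (n%:R `^ (k%:~R / 2))%:C * int_jslash k (m%:~R * n%:R) n%:R M 0 f tau z.
Proof.
move=> n0 dM tH; rewrite /slash /slash1 /int_jslash /jslash /= det_map_mx dM !mxE.
rewrite !mulr0z !mul0r !mulr0 !addr0 expr0n /= !mul0r !addr0.
have s0 : 0 < Num.sqrt n%:R :> R by rewrite sqrtr_gt0 ltr0n.
have -> : n%:R `^ (k%:~R / 2) = Num.sqrt n%:R ^ k :> R.
  by rewrite mulrC powRrM powR12_sqrt// powR_intmul// ltW.
have ss : (Num.sqrt n%:R)%:C * (Num.sqrt n%:R)%:C = n%:R :> R[i].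
  by rewrite -rmorphM -expr2 sqr_sqrtr// rmorph_nat.
rewrite rmorphXz; last by rewrite unitfE gt_eqF.
have rcM x y : (x * y)%:C = x%:C * y%:C :> R[i] by rewrite rmorphM.
have rcV x : (x^-1)%:C = x%:C^-1 :> R[i] by rewrite fmorphV.
rewrite !rcM !real_complex_int !rcV.
set s := (Num.sqrt _)%:C in ss *.
have sC : s != 0 by rewrite fmorph_eq0 gt_eqF.
rewrite -/s.
have := int_affine_uhp_neq0 (M := M) tH; rewrite dM ltz_nat => /(_ n0) j0.
have sD x y w : s^-1 * x * w + s^-1 * y = s^-1 * (x * w + y) by ring.
rewrite !sD expfzMl exprz_inv opprK -ss -2!(mulrA (s ^ k)).
by congr (_ * (_ * cexp _ * f _ _)); field; rewrite ?sC ?j0.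
Qed.

(** * Representatives of SL_2(Z) \ M_n *)

Lemma forall_I2I2 (P : 'I_2 -> 'I_2 -> Prop) :
  P 0 0 -> P 0 1 -> P 1 0 -> P 1 1 -> forall i j, P i j.
Proof.
have E (k : 'I_1) : lift 0 k = 1 :> 'I_2 by rewrite (ord1 k); apply: val_inj.
move=> ? ? ? ? i j.
by case: (unliftP 0 i) => [i'|] ->; case: (unliftP 0 j) => [j'|] ->; rewrite ?E.
Qed.

Lemma eq_mx22 (A : Type) (M N : 'M[A]_2) :
  M 0 0 = N 0 0 -> M 0 1 = N 0 1 -> M 1 0 = N 1 0 -> M 1 1 = N 1 1 -> M = N.
Proof. by move=> ? ? ? ?; apply/matrixP; apply: forall_I2I2. Qed.

Lemma mx22E (A : Type) (a b c d : A) :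
  ((mx22 a b c d 0 0 = a) * (mx22 a b c d 0 1 = b) *
   (mx22 a b c d 1 0 = c) * (mx22 a b c d 1 1 = d))%type.
Proof. by rewrite !mxE. Qed.

Definition hecke_reps (n : nat) : seq (nat * nat) :=
  [seq (d, b) | d <- divisors n, b <- iota 0 d].

Definition hecke_mx (n : nat) (p : nat * nat) : 'M[int]_2 :=
  mx22 (n %/ p.1)%N%:Z p.2%:Z 0 p.1%:Z.

Lemma mem_hecke_reps n p : (0 < n)%N ->
  (p \in hecke_reps n) = (p.1 %| n)%N && (p.2 < p.1)%N.
Proof.
case: p => d b n0; apply/allpairsPdep/andP => /= [[d' [b' []]]|[dn bd]].
  by rewrite -dvdn_divisors// mem_iota => dn bd [-> ->].
by exists d, b; rewrite -dvdn_divisors// mem_iota.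
Qed.

Lemma uniq_hecke_reps n : uniq (hecke_reps n).
Proof.
apply: allpairs_uniq_dep; first exact: divisors_uniq.
  by move=> d _; exact: iota_uniq.
by move=> [d b] [d' b'] _ _ /= [-> ->].
Qed.

Lemma big_hecke_reps (V : nmodType) n (F : nat -> nat -> V) :
  \sum_(p <- hecke_reps n) F p.1 p.2 =
  \sum_(d <- divisors n) \sum_(0 <= b < d) F d b.
Proof.
rewrite big_allpairs_dep; apply: eq_bigr => d _ /=.
by rewrite /index_iota subn0.
Qed.

Lemma det_hecke_mx n p : (p.1 %| n)%N -> \det (hecke_mx n p) = n%:Z.
Proof. by move=> pn; rewrite det_mx22 !mx22E mulr0 subr0 -PoszM divnK. Qed.

(** Hermite normal form: a Bezout relation for the first column clears the lower left entry, then
    division with remainder brings the upper right entry into $[0,d)$. *)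
Lemma hecke_mx_decomp (n : nat) (B : 'M[int]_2) : (0 < n)%N -> \det B = n%:Z ->
  exists N p, [/\ \det N = 1, p \in hecke_reps n & B = N *m hecke_mx n p].
Proof.
move=> n0; rewrite det_mx22.
set p := B 0 0; set q := B 0 1; set r := B 1 0; set s := B 1 1 => dB.
have [u [v]] := Bezoutz p r; set g := gcdz p r => uv.
have /dvdzP[p' pE] : (g %| p)%Z by exact: dvdz_gcdl.
have /dvdzP[r' rE] : (g %| r)%Z by exact: dvdz_gcdr.
have g0 : 0 < g.
  rewrite lt_neqAle (_ : 0 <= g) ?andbT; last by []; apply/eqP => g0; move: dB.
  by rewrite pE rE -g0 !mulr0 mul0r subrr; lia.
have upv : u * p' + v * r' = 1.
  by apply: (mulIf (lt0r_neq0 g0)); rewrite mul1r -[RHS]uv pE rE; ring.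
pose d := p' * s - r' * q.
have gd : g * d = n%:Z by rewrite -dB pE rE /d; ring.
have d0 : 0 < d by move: gd g0 n0; nia.
(* The matrix [(u, v; - r', p')] of determinant 1 sends [B] to [(g, x; 0, d)]. *)
pose x := u * q + v * s.
pose j := (x %/ d)%Z; pose b := (x %% d)%Z.
have xE : x = j * d + b by exact: divz_eq.
have b0 : 0 <= b by rewrite modz_ge0 ?gt_eqF.
have bd : b < d by exact: ltz_pmod.
(* The first witness is the inverse [(p', - v; r', u)] of that matrix, times the translation
   [(1, j; 0, 1)]. *)
exists (mx22 p' (- v + p' * j) r' (u + r' * j)), (`|d|%N, `|b|%N).
have dn : (`|d| %| n)%N by apply/dvdnP; exists `|g|%N; lia.
split.
- by rewrite det_mx22 !mx22E -upv; ring.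
- by rewrite mem_hecke_reps// dn /=; lia.
have dg : (n %/ `|d|)%N%:Z = g.
  have -> : n = (`|g| * `|d|)%N by lia.
  by rewrite mulnK; lia.
have dE : `|d|%N%:Z = d by lia.
have bE : `|b|%N%:Z = b by lia.
have bx : b = x - j * d by rewrite xE; ring.
apply: eq_mx22; rewrite !mulmx22E !mx22E /= ?dg ?dE ?bE ?mulr0 ?addr0 -/p -/q -/r -/s //.
- rewrite bx /x {1}/d.
  transitivity ((u * p' + v * r') * q); first by rewrite upv mul1r.
  by rewrite /d; ring.
- rewrite bx /x {1}/d.
  transitivity ((u * p' + v * r') * s); first by rewrite upv mul1r.
  by rewrite /d; ring.
Qed.

(** The bottom rows force [N] to be upper triangular, and positivity makes its diagonal entries 1.
    The two upper right entries then differ by a multiple of $d$ and both lie in $[0,d)$. *)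
Lemma hecke_mx_inj (n : nat) (N : 'M[int]_2) p q : (0 < n)%N -> \det N = 1 ->
  p \in hecke_reps n -> q \in hecke_reps n ->
  hecke_mx n p = N *m hecke_mx n q -> p = q.
Proof.
case: p => d b; case: q => d' b' n0.
rewrite det_mx22 !mem_hecke_reps//= => dN /andP[dn bd] /andP[dn' bd'] /matrixP E.
have := E 1 0; have := E 1 1; have := E 0 1.
rewrite !mulmx22E !mx22E /= !mulr0 addr0 => E01 E11 E10.
have a0 : (0 < n %/ d')%N by rewrite divn_gt0 ?(dvdn_leq n0 dn')//; lia.
have N10 : N 1 0 = 0.
  by apply/eqP; move/esym/eqP: E10; rewrite mulf_eq0 => /orP[//|]; lia.
rewrite N10 mulr0 subr0 in dN; rewrite N10 mul0r add0r in E11.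
have N11p : 0 < N 1 1.
  by rewrite -(pmulr_lgt0 (x := d'%:Z)) -?E11; lia.
have N00p : 0 < N 0 0 by rewrite -(pmulr_lgt0 (x := N 1 1)) ?dN.
have N11 : N 1 1 = 1 by nia.
have N00 : N 0 0 = 1 by rewrite N11 mulr1 in dN.
rewrite N11 mul1r in E11; rewrite N00 mul1r in E01.
have N01 : N 0 1 = 0 by nia.
by congr pair; [|rewrite N01 mul0r addr0 in E01]; lia.
Qed.

(** Reducing [A M] to its representative defines [h]. It is an injective self-map of a finite list,
    hence a permutation. *)
Lemma hecke_reps_mulr (n : nat) (M : 'M[int]_2) : (0 < n)%N -> \det M = 1 ->
  exists (h : nat * nat -> nat * nat) (N : nat * nat -> 'M[int]_2),
    perm_eq (map h (hecke_reps n)) (hecke_reps n) /\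
    forall p, p \in hecke_reps n ->
      [/\ \det (N p) = 1, h p \in hecke_reps n &
          hecke_mx n p *m M = N p *m hecke_mx n (h p)].
Proof.
move=> n0 dM.
have /choice[F FP] (p : nat * nat) : exists y : ('M[int]_2 * (nat * nat)),
  p \in hecke_reps n -> [/\ \det y.1 = 1, y.2 \in hecke_reps n &
      hecke_mx n p *m M = y.1 *m hecke_mx n y.2].
  have [pn|] := boolP (p \in hecke_reps n); last by exists (0, p).
  have [|N [q [? ? ?]]] := @hecke_mx_decomp n (hecke_mx n p *m M) n0.
    rewrite det_mulmx dM mulr1 det_hecke_mx//.
    by move: pn; rewrite mem_hecke_reps// => /andP[].
  by exists (N, q).
exists (fun p => (F p).2), (fun p => (F p).1); split=> [|p /FP//].
have uM : M \in unitmx by rewrite unitmxE dM unitr1.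
(* If [h p = h q], cancelling [M] puts the representatives of [p] and [q] in the same left class. *)
have U : uniq (map (fun p => (F p).2) (hecke_reps n)).
  rewrite map_inj_in_uniq ?uniq_hecke_reps// => p q pn qn pq.
  have [dp hp ep] := FP _ pn; have [dq hq eq] := FP _ qn.
  have uq : (F q).1 \in unitmx by rewrite unitmxE dq unitr1.
  apply: (@hecke_mx_inj n ((F p).1 *m invmx (F q).1)) => //.
    by rewrite det_mulmx det_inv dp dq invr1 mulr1.
  by apply: (can_inj (mulmxK uM)); rewrite ep -!mulmxA eq -pq mulKmx.
apply: uniq_perm; rewrite ?uniq_hecke_reps//.
by apply: (uniq_min_size U _ _).2; rewrite ?size_map// => _ /mapP[p /FP[? ? ?] ->].
Qed.

(** * The identity between the formal sums *)

Lemma set_bij_can (T U : Type) (A : set T) (B : set U) (f : T -> U) (g : U -> T) :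
  (forall x, A x -> B (f x) /\ g (f x) = x) ->
  (forall y, B y -> A (g y) /\ f (g y) = y) -> set_bij A B f.
Proof.
move=> fP gP; split.
- by move=> x /fP[].
- by move=> x y /set_mem/fP[_ {2}<-] /set_mem/fP[_ {2}<-] -> .
- by move=> y /gP[Ag fg]; exists (g y).
Qed.

(** Adding [N] to every entry lands in $\{0,\dots,2N\}$, so [A] lies in the image of a finite type
    of matrices. *)
Lemma finite_bounded_mx (m n N : nat) (A : set 'M[int]_(m, n)) :
  (forall M, A M -> forall i j, `|M i j| <= N%:Z) -> finite_set A.
Proof.
move=> AN.
apply: (@sub_finite_set _ _ ((fun M : 'M['I_(N + N).+1]_(m, n) =>
  \matrix_(i, j) ((M i j : nat)%:Z - N%:Z)) @` setT)); last exact: finite_image.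
move=> M /AN MN; exists (\matrix_(i, j) inord (absz (M i j + N%:Z))) => //.
apply/matrixP => i j; rewrite !mxE inordK; have := MN i j; move: (M i j) => x; lia.
Qed.

(** The parameter [e] decides whether the midpoint [2 * b = d] belongs to the set: it does for
    [e = 1] and does not for [e = 0]. Both versions occur because balanced residue systems are half
    open. *)
Definition upper_pos (n : nat) (e : int) : set 'M[int]_2 :=
  [set M | [/\ M 1 0 = 0, M 0 0 * M 1 1 = n%:Z,
               0 < M 0 1 & 2 * M 0 1 < M 1 1 + e]].

Definition lower_pos (n : nat) (e : int) : set 'M[int]_2 :=
  [set M | [/\ M 0 1 = 0, M 0 0 * M 1 1 = n%:Z,
               0 < M 1 0 & 2 * M 1 0 < M 0 0 + e]].

Definition diag_pos (n : nat) : set 'M[int]_2 :=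
  [set M | [/\ M 0 1 = 0, M 1 0 = 0, M 0 0 * M 1 1 = n%:Z & 0 < M 1 1]].

(** Here $n=ad+|b|c$ with $a,d,|b|,c\ge 1$, so each entry is at most $n$ in absolute value. Products
    such as $(a-1)(d-1)\ge 0$ supply the nonlinear arithmetic. *)
Lemma finite_Vtilde_set1 n : finite_set (Vtilde_set1 n).
Proof.
apply: (@finite_bounded_mx _ _ n) => M [].
move Ea : (M 0 0) => a; move Eb : (M 0 1) => b;
move Ec : (M 1 0) => c; move Ed : (M 1 1) => d.
move=> det_n ca c0 bd b0.
have ad : 0 <= (a - 1) * (d - 1) by rewrite mulr_ge0; lia.
have bc : 0 <= (- b - 1) * (c - 1) by rewrite mulr_ge0; lia.
by apply: forall_I2I2; rewrite ?Ea ?Eb ?Ec ?Ed; nia.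
Qed.

Lemma finite_Vtilde_set2 n : (0 < n)%N -> finite_set (Vtilde_set2 n).
Proof.
move=> n0; apply: (@finite_bounded_mx _ _ n) => M [].
move Ea : (M 0 0) => a; move Eb : (M 0 1) => b;
move Ec : (M 1 0) => c; move Ed : (M 1 1) => d.
move=> c0 det_n db bd.
have [ap dp] : 0 < a /\ 0 < d by nia.
have ad : 0 <= (a - 1) * (d - 1) by rewrite mulr_ge0; lia.
by apply: forall_I2I2; rewrite ?Ea ?Eb ?Ec ?Ed; nia.
Qed.

Lemma finite_Vtilde_set3 n : (0 < n)%N -> finite_set (Vtilde_set3 n).
Proof.
move=> n0; apply: (@finite_bounded_mx _ _ n) => M [].
move Ea : (M 0 0) => a; move Eb : (M 0 1) => b;
move Ec : (M 1 0) => c; move Ed : (M 1 1) => d.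
move=> b0 det_n ac ca c0.
have [ap dp] : 0 < a /\ 0 < d by nia.
have ad : 0 <= (a - 1) * (d - 1) by rewrite mulr_ge0; lia.
by apply: forall_I2I2; rewrite ?Ea ?Eb ?Ec ?Ed; nia.
Qed.

Lemma finite_diag_pos n : (0 < n)%N -> finite_set (diag_pos n).
Proof.
move=> n0; apply: (@finite_bounded_mx _ _ n) => M [].
move Ea : (M 0 0) => a; move Eb : (M 0 1) => b;
move Ec : (M 1 0) => c; move Ed : (M 1 1) => d.
move=> b0 c0 det_n d0.
have [ap dp] : 0 < a /\ 0 < d by nia.
have ad : 0 <= (a - 1) * (d - 1) by rewrite mulr_ge0; lia.
by apply: forall_I2I2; rewrite ?Ea ?Eb ?Ec ?Ed; nia.
Qed.

Lemma finite_upper_pos n e : (0 < n)%N -> 0 <= e <= 1 -> finite_set (upper_pos n e).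
Proof.
move=> n0 e01; apply: (@finite_bounded_mx _ _ n) => M [].
move Ea : (M 0 0) => a; move Eb : (M 0 1) => b;
move Ec : (M 1 0) => c; move Ed : (M 1 1) => d.
move=> c0 det_n b0 bd.
have [ap dp] : 0 < a /\ 0 < d by nia.
have ad : 0 <= (a - 1) * (d - 1) by rewrite mulr_ge0; lia.
by apply: forall_I2I2; rewrite ?Ea ?Eb ?Ec ?Ed; nia.
Qed.

Lemma finite_lower_pos n e : (0 < n)%N -> 0 <= e <= 1 -> finite_set (lower_pos n e).
Proof.
move=> n0 e01; apply: (@finite_bounded_mx _ _ n) => M [].
move Ea : (M 0 0) => a; move Eb : (M 0 1) => b;
move Ec : (M 1 0) => c; move Ed : (M 1 1) => d.
move=> b0 det_n c0 ca.
have [ap dp] : 0 < a /\ 0 < d by nia.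
have ad : 0 <= (a - 1) * (d - 1) by rewrite mulr_ge0; lia.
by apply: forall_I2I2; rewrite ?Ea ?Eb ?Ec ?Ed; nia.
Qed.

(* Both maps preserve the class modulo left multiplication by [(1, 1; 0, 1)] of
   [M], respectively of [(c, -d; a, |b|)]: the two sets are two systems of
   representatives for the classes with bottom row [(p, q)], [p, q > 0], such
   that the interval []s / q, r / p[] between the quotients of the top row
   [(r, s)] by the bottom row contains two consecutive integers. *)
Definition euclid_fwd (M : 'M[int]_2) : 'M[int]_2 :=
  let q := divz (M 0 0) (M 1 0) in let r := modz (M 0 0) (M 1 0) in
  mx22 (M 1 0) (if r == 0 then M 1 1 else - M 1 1) r (q * M 1 1 - M 0 1).

Definition euclid_bwd (M : 'M[int]_2) : 'M[int]_2 :=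
  let q := divz (M 1 1) `|M 0 1| in let r := modz (M 1 1) `|M 0 1| in
  mx22 (q * M 0 0 + M 1 0) (- r) (M 0 0) `|M 0 1|.

(** A nonzero remainder lands in [Vtilde_set1], a zero remainder in the triangular set. Between
    triangular matrices [e] is respected: [2 * c < q * c + e] and [2 * d < q * d + e] both say
    [2 < q] for [e = 0] and [2 <= q] for [e = 1]. *)
Lemma euclid_bij (n : nat) (e : int) : (0 < n)%N -> 0 <= e <= 1 ->
  set_bij (Vtilde_set1 n `|` lower_pos n e) (Vtilde_set1 n `|` upper_pos n e)
    euclid_fwd.
Proof.
move=> n0 e01; apply: (@set_bij_can _ _ _ _ _ euclid_bwd) => M;
  rewrite /euclid_bwd /euclid_fwd.
  rewrite /= !mx22E /setU /Vtilde_set1 /lower_pos /upper_pos /mkset /= !mx22E.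
  move Ea : (M 0 0) => a; move Eb : (M 0 1) => b;
  move Ec : (M 1 0) => c; move Ed : (M 1 1) => d H.
  have c0 : 0 < c by case: H => -[].
  have d0 : 0 < d by case: H => -[]; nia.
  have bd : - d < b /\ b <= 0 by case: H => -[]; lia.
  have dE : `|if (a %% c)%Z == 0 then d else - d| = d by case: ifP; lia.
  rewrite dE.
  have cr : 0 <= (a %% c)%Z by rewrite modz_ge0 ?gt_eqF.
  have rc : (a %% c)%Z < c by exact: ltz_pmod.
  have aE : a = (a %/ c)%Z * c + (a %% c)%Z by exact: divz_eq.
  (* As [0 <= - b < d], division of [q * d - b] by [d] returns [q] and [- b], so [euclid_bwd] undoes
     the step. *)
  have qd : (((a %/ c)%Z * d - b) %/ d)%Z = (a %/ c)%Z.
    by rewrite divzMDl ?gt_eqF// (@divz_small (- b)) ?addr0//; lia.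
  have rd : (((a %/ c)%Z * d - b) %% d)%Z = - b.
    by rewrite modzMDl (@modz_small (- b))//; lia.
  split; last by apply: eq_mx22; rewrite !mx22E /= ?Ea ?Eb ?Ec ?Ed ?qd ?rd; lia.
  move: (a %/ c)%Z (a %% c)%Z aE cr rc {qd rd dE} => q r aE cr rc.
  have ca : c < a by case: H => -[]; lia.
  (* Since [c < a], the quotient is at least 1, and at least 2 when the remainder vanishes. *)
  have q1 : 0 <= (q - 1) * d by rewrite mulr_ge0//; nia.
  have q2 : r = 0 -> 0 <= (q - 2) * d by move=> r0; rewrite mulr_ge0//; nia.
  have q3 : r = 0 -> 2 * c < a + e -> 2 * d < q * d + e.
    move=> r0; have [->|->] : e = 0 \/ e = 1 by lia.
      by rewrite !addr0 aE r0 addr0 (ltr_pM2r c0) (ltr_pM2r d0).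
    by have := q2 r0; lia.
  case: eqP => [r0|r0]; [have {}q2 := q2 r0; have {}q3 := q3 r0; right|left];
    split; case: H => -[]; nia.
rewrite /= !mx22E /setU /Vtilde_set1 /lower_pos /upper_pos /mkset /= !mx22E.
move Ea : (M 0 0) => a; move Eb : (M 0 1) => b;
move Ec : (M 1 0) => c; move Ed : (M 1 1) => d H.
have b0 : 0 < `|b| by case: H => -[]; lia.
have d0 : 0 < d by case: H => -[]; nia.
have a0 : 0 < a by case: H => -[]; nia.
have ca : 0 <= c /\ c < a by case: H => -[]; lia.
have db : `|b| < d by case: H => -[]; lia.
have r0 : 0 <= (d %% `|b|)%Z by rewrite modz_ge0 ?gt_eqF.
have rb : (d %% `|b|)%Z < `|b| by exact: ltz_pmod.
have dE : d = (d %/ `|b|)%Z * `|b| + (d %% `|b|)%Z by exact: divz_eq.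
have qa : (((d %/ `|b|)%Z * a + c) %/ a)%Z = (d %/ `|b|)%Z.
  by rewrite divzMDl ?gt_eqF// (@divz_small c) ?addr0//; lia.
have ra : (((d %/ `|b|)%Z * a + c) %% a)%Z = c.
  by rewrite modzMDl (@modz_small c)//; lia.
split; last first.
  apply: eq_mx22; rewrite !mx22E /= ?Ea ?Eb ?Ec ?Ed ?qa ?ra; try case: eqP;
    case: H => -[]; lia.
move: (d %/ `|b|)%Z (d %% `|b|)%Z dE r0 rb {qa ra} => q r dE r0 rb.
have q1 : 0 <= (q - 1) * a by rewrite mulr_ge0; nia.
have q2 : r = 0 \/ c = 0 -> 0 <= (q - 2) * a.
  by move=> rc; rewrite mulr_ge0//; case: H => -[] *; case: rc => ?; nia.
have q3 : r = 0 -> c = 0 -> 2 * `|b| < d + e -> 2 * a < q * a + e.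
  move=> r1 c1; have [->|->] : e = 0 \/ e = 1 by lia.
    by rewrite !addr0 dE r1 addr0 (ltr_pM2r b0) (ltr_pM2r a0).
  by have := q2 (or_introl r1); lia.
have [rE|rE] := eqVneq r 0; [have {}q3 := q3 rE; right|left];
  split; case: H => -[]; nia.
Qed.

Lemma euclid_sum (V : zmodType) (n : nat) (e : int) (g : int -> int -> int -> int -> V) :
  (0 < n)%N -> 0 <= e <= 1 ->
  (forall a b c d j, a * d - b * c = n%:Z -> g (a + j * c) (b + j * d) c d = g a b c d) ->
  \sum_(M \in Vtilde_set1 n) g (M 1 0) (- M 1 1) (M 0 0) (- M 0 1) +
    \sum_(M \in upper_pos n e) g 0 (- M 1 1) (M 0 0) (M 0 1) =
  \sum_(M \in Vtilde_set1 n) g (M 0 0) (M 0 1) (M 1 0) (M 1 1) +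
    \sum_(M \in lower_pos n e) g (M 0 0) (M 0 1) (M 1 0) (M 1 1).
Proof.
move=> n0 e01 gU.
rewrite -[RHS]fsbigU; first last.
- by move=> M [[_ _ _ _ b] [b0 _ _ _]]; move: b; rewrite b0 oppr0 ltxx.
- exact: finite_lower_pos.
- exact: finite_Vtilde_set1.
(* The absolute value serves both pieces: [M 0 1] is negative on [Vtilde_set1] and positive on
   [upper_pos]. *)
pose G (M : 'M[int]_2) := g (M 1 0) (- M 1 1) (M 0 0) `|M 0 1|.
transitivity (\sum_(M \in Vtilde_set1 n `|` upper_pos n e) G M).
  rewrite fsbigU; first last.
  - by move=> M [[_ _ c _ _] [c0 _ _ _]]; move: c; rewrite c0 ltxx.
  - exact: finite_upper_pos.
  - exact: finite_Vtilde_set1.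
  congr (_ + _); apply: eq_fsbigr => M /set_mem; rewrite /G.
    by move=> [_ _ _ _ b0]; rewrite ltr0_norm// -oppr_gt0.
  by move=> [-> _ b0 _]; rewrite gtr0_norm.
rewrite (reindex_fsbig _ _ _ _ (euclid_bij n0 e01)).
apply: eq_fsbigr => M /set_mem H.
rewrite /G /euclid_fwd !mx22E.
set q := divz _ _; set r := modz _ _.
have aE : M 0 0 = q * M 1 0 + r by exact: divz_eq.
have dE : `|if r == 0 then M 1 1 else - M 1 1| = M 1 1.
  have ? : 0 < M 1 1.
    case: H => -[]; first by move=> _ _ _ bd b0; exact: lt_trans bd.
    move=> _ ad c0 ca; have a0 : 0 < M 0 0 by move: (M 0 0) (M 1 0) c0 ca; lia.
    by rewrite -(pmulr_rgt0 _ a0) ad.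
  by case: ifP => _; rewrite ?normrN gtr0_norm.
have D : M 0 0 * M 1 1 - M 0 1 * M 1 0 = n%:Z.
  by case: H => -[] // -> -> _ _; rewrite mul0r subr0.
(* Left translation by the Euclidean quotient carries the image back to [M]. *)
rewrite dE -(gU _ _ _ _ q); first by congr g; rewrite ?aE; ring.
by rewrite -D aE; ring.
Qed.

(* Balanced residues modulo [d] instead of [0, ..., d - 1]. *)
Lemma sum_Vtilde_set2 (V : zmodType) (n : nat) (g : int -> int -> int -> int -> V) :
  (0 < n)%N ->
  (forall a b c d j, a * d - b * c = n%:Z -> g (a + j * c) (b + j * d) c d = g a b c d) ->
  \sum_(M \in Vtilde_set2 n) g (M 0 0) (M 0 1) (M 1 0) (M 1 1) =
  \sum_(p <- hecke_reps n) g (n %/ p.1)%N p.2 0 p.1.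
Proof.
move=> n0 gU; rewrite [RHS]fsbig_seq ?uniq_hecke_reps//.
pose h (p : nat * nat) : 'M[int]_2 := mx22 (n %/ p.1)%N%:Z
  (if (2 * p.2 <= p.1)%N then p.2%:Z else p.2%:Z - p.1%:Z) 0 p.1.
pose h' (M : 'M[int]_2) : nat * nat := (absz (M 1 1), absz (modz (M 0 1) (M 1 1))).
have hP : set_bij [set` hecke_reps n] (Vtilde_set2 n) h.
  apply: (@set_bij_can _ _ _ _ _ h') => [[d b]|M] /=.
    rewrite mem_hecke_reps//= => /andP[dn bd].
    rewrite /Vtilde_set2 /h' /h /mkset /= !mx22E /=.
    have nE : (n %/ d)%N%:Z * d%:Z = n by rewrite -PoszM divnK.
    split; first by split=> //; case: ifP; lia.
    congr pair; case: ifP => _.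
      by rewrite modz_small//; lia.
    by rewrite -[_ - _]addrC -mulN1r modzMDl modz_small//; lia.
  rewrite /Vtilde_set2 /h' /h /mkset /=.
  move Ea : (M 0 0) => a; move Eb : (M 0 1) => b;
  move Ec : (M 1 0) => c; move Ed : (M 1 1) => d.
  move=> [c0 adn db bd].
  have d0 : 0 < d by lia.
  have a0 : 0 < a by nia.
  have m0 : 0 <= modz b d by rewrite modz_ge0 ?gt_eqF.
  have md : modz b d < d by exact: ltz_pmod.
  have := divz_eq b d; move: (divz b d) (modz b d) m0 md => q r r0 rd bE.
  (* A balanced [b], with [- d < 2 * b <= d], admits only these quotients. *)
  have qE : q = 0 \/ q = -1.
    have h1 : -2 * d < q * d by lia.
    have h2 : q * d < 1 * d by lia.
    by rewrite !(ltr_pM2r d0) in h1 h2; lia.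
  have nE : n = (`|a| * `|d|)%N by nia.
  rewrite mem_hecke_reps//=; split.
    by rewrite {1}nE dvdn_mull//=; lia.
  apply: eq_mx22; rewrite !mx22E /= ?Ea ?Eb ?Ec ?Ed ?c0//.
  - by rewrite nE mulnK; lia.
  - by case: ifP; case: qE => qE; rewrite qE in bE; lia.
  - by lia.
rewrite (reindex_fsbig _ _ _ _ hP); apply: eq_fsbigr => -[d b] /set_mem /=.
rewrite mem_hecke_reps//= /h => /andP[dn bd]; rewrite !mx22E /=; case: ifP => // _.
have nE : (n %/ d)%N%:Z * d%:Z = n by rewrite -PoszM divnK.
rewrite -(gU _ _ _ _ 1); last by rewrite mulr0 subr0.
by rewrite !mul1r addr0 subrK.
Qed.

(** Conjugation by $S=(0,-1;1,0)$ exchanges the two kinds of triangular matrices. This reduces the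
    claim to the upper triangular case for $A\mapsto g(AS)$, the function [g'] below. *)
Lemma sum_Vtilde_set3 (V : zmodType) (n : nat) (g : int -> int -> int -> int -> V) :
  (0 < n)%N ->
  (forall a b c d j, a * d - b * c = n%:Z -> g (a + j * c) (b + j * d) c d = g a b c d) ->
  \sum_(M \in Vtilde_set3 n) g (- M 1 0) (- M 1 1) (M 0 0) (M 0 1) +
    \sum_(M \in diag_pos n) g (- M 1 0) (- M 1 1) (M 0 0) (M 0 1) =
  \sum_(p <- hecke_reps n) g p.2 (- (n %/ p.1)%N%:Z) p.1 0.
Proof.
move=> n0 gU; rewrite -fsbigU; first last.
- by move=> M [[_ _ _ _ c0] [_ c0' _ _]]; move: c0; rewrite c0' eqxx.
- exact: finite_diag_pos.
- exact: finite_Vtilde_set3.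
pose g' a b c d := g b (- a) d (- c).
have g'U a b c d j : a * d - b * c = n%:Z -> g' (a + j * c) (b + j * d) c d = g' a b c d.
  by move=> D; rewrite /g' opprD -mulrN gU// -D; ring.
have := sum_Vtilde_set2 n0 g'U; rewrite /g' oppr0 => <-.
(* Conjugation would negate the off-diagonal entry; at the midpoint the sign is kept, since the
   half-open interval contains only the positive midpoint. *)
pose h (M : 'M[int]_2) : 'M[int]_2 :=
  mx22 (M 1 1) 0 (if 2 * M 0 1 == M 1 1 then M 0 1 else - M 0 1) (M 0 0).
pose h' (M : 'M[int]_2) : 'M[int]_2 :=
  mx22 (M 1 1) (if 2 * M 1 0 == M 0 0 then M 1 0 else - M 1 0) 0 (M 0 0).
have hP : set_bij (Vtilde_set2 n) (Vtilde_set3 n `|` diag_pos n) h.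
  apply: (@set_bij_can _ _ _ _ _ h') => M;
    rewrite /h /h' /setU /Vtilde_set2 /Vtilde_set3 /diag_pos /mkset /= !mx22E;
    move Ea : (M 0 0) => a; move Eb : (M 0 1) => b;
    move Ec : (M 1 0) => c;
    move Ed : (M 1 1) => d.
    move=> [c0 adn db bd]; split.
      have [b0|b0] := eqVneq b 0; [right|left].
        have d0 : 0 < d by lia.
        have a0 : 0 < a by rewrite -(pmulr_lgt0 _ d0) adn.
        by rewrite b0 mulr0; split=> //; [case: ifP; rewrite ?oppr0|rewrite mulrC].
      by split=> //; [rewrite mulrC|case: ifP; lia|case: ifP; lia|case: ifP; lia].
    apply: eq_mx22; rewrite !mx22E ?Ea ?Eb ?Ec ?Ed//.
    by case: (2 * b =P d) => [->|?]; rewrite ?eqxx//; case: eqP; lia.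
  move=> H.
  have [b0 adn ac ca] : [/\ b = 0, a * d = n, - a < 2 * c & 2 * c <= a].
    case: H => -[] // -> -> adn d0; split=> //.
      by rewrite mulr0 oppr_lt0 -(pmulr_lgt0 _ d0) adn.
    by rewrite mulr0 ltW// -(pmulr_lgt0 _ d0) adn.
  split; first by split=> //; [rewrite mulrC|case: ifP; lia|case: ifP; lia].
  apply: eq_mx22; rewrite !mx22E ?Ea ?Eb ?Ec ?Ed//.
  by case: (2 * c =P a) => [->|?]; rewrite ?eqxx//; case: eqP; lia.
rewrite (reindex_fsbig _ _ _ _ hP); apply: eq_fsbigr => M /set_mem[c0 adn db bd].
rewrite /h !mx22E c0 oppr0; case: eqP => [bdE|_]; last by rewrite opprK.
(* At the midpoint [b] and [- b] differ by [d], that is, by one translation. *)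
rewrite -(gU _ _ _ _ 1); last by rewrite mulr0 sub0r mulNr opprK.
by rewrite mulr0 addr0 -bdE; congr g; ring.
Qed.

Ltac mx_entries M :=
  rewrite /setU /setI /preimage /Vtilde_set1 /Vtilde_set2 /Vtilde_set3
    /upper_pos /lower_pos /diag_pos /mkset /= ?mx22E;
  move: (M 0 0) (M 0 1) (M 1 0) (M 1 1) => a b c d.

(** Split by the sign of $b$: a positive $b$ may reach the midpoint, whence [e = 1]; a negative one
    reflects to a positive one strictly below it, whence [e = 0]. *)
Lemma sum_Vtilde_set2_split (V : nmodType) (n : nat) (F : 'M[int]_2 -> V) : (0 < n)%N ->
  \sum_(M \in Vtilde_set2 n) F M =
  \sum_(M \in upper_pos n 1) F M + \sum_(M \in diag_pos n) F M +
  \sum_(M \in upper_pos n 0) F (mx22 (M 0 0) (- M 0 1) (M 1 0) (M 1 1)).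
Proof.
move=> n0.
pose h (M : 'M[int]_2) := mx22 (M 0 0) (- M 0 1) (M 1 0) (M 1 1).
have hK : cancel h h by move=> M; apply: eq_mx22; rewrite !mx22E ?opprK.
have hP : set_bij (upper_pos n 0) (h @^-1` upper_pos n 0) h.
  by apply: (@set_bij_can _ _ _ _ _ h) => M HM; split; rewrite ?hK//= hK.
rewrite -(reindex_fsbig h _ _ F hP).
have f1 : finite_set (upper_pos n 1) by exact: finite_upper_pos.
have f2 := finite_diag_pos n0.
have f3 : finite_set (h @^-1` upper_pos n 0).
  rewrite (_ : h @^-1` _ = h @` upper_pos n 0).
    by apply: finite_image; exact: finite_upper_pos.
  by apply/seteqP; split=> [M HM|_ [M HM <-]]; [exists (h M)|rewrite /= hK].
have d12 M : (upper_pos n 1 `&` diag_pos n) M -> False.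
  by mx_entries M; case=> -[? ? ? ?] [? ? ? ?]; lia.
have d3 M : ((upper_pos n 1 `|` diag_pos n) `&` h @^-1` upper_pos n 0) M -> False.
  by rewrite /h; mx_entries M; case=> -[] [? ? ? ?] [? ? ? ?]; lia.
rewrite -!fsbigU//; [|by rewrite finite_setU|by move=> M /d3|by move=> M /d12].
congr (\sum_(M \in _) _); apply/seteqP; rewrite /h; split => M; mx_entries M.
  move=> [c0 adn db bd]; have [b0|b0|b0] := ltgtP b 0.
  - by right; split=> //; lia.
  - by left; left; split=> //; lia.
  - by left; right; split=> //; lia.
by case=> [[|]|] [] *; split=> //; lia.
Qed.

Lemma sum_Vtilde_set3_split (V : nmodType) (n : nat) (F : 'M[int]_2 -> V) : (0 < n)%N ->
  \sum_(M \in Vtilde_set3 n) F M =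
  \sum_(M \in lower_pos n 1) F M +
  \sum_(M \in lower_pos n 0) F (mx22 (M 0 0) (M 0 1) (- M 1 0) (M 1 1)).
Proof.
move=> n0.
pose h (M : 'M[int]_2) := mx22 (M 0 0) (M 0 1) (- M 1 0) (M 1 1).
have hK : cancel h h by move=> M; apply: eq_mx22; rewrite !mx22E ?opprK.
have hP : set_bij (lower_pos n 0) (h @^-1` lower_pos n 0) h.
  by apply: (@set_bij_can _ _ _ _ _ h) => M HM; split; rewrite ?hK//= hK.
rewrite -(reindex_fsbig h _ _ F hP).
have f1 : finite_set (lower_pos n 1) by exact: finite_lower_pos.
have f3 : finite_set (h @^-1` lower_pos n 0).
  rewrite (_ : h @^-1` _ = h @` lower_pos n 0).
    by apply: finite_image; exact: finite_lower_pos.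
  by apply/seteqP; split=> [M HM|_ [M HM <-]]; [exists (h M)|rewrite /= hK].
have d3 M : (lower_pos n 1 `&` h @^-1` lower_pos n 0) M -> False.
  by rewrite /h; mx_entries M; case=> -[? ? ? ?] [? ? ? ?]; lia.
rewrite -!fsbigU//; last by move=> M /d3.
congr (\sum_(M \in _) _); apply/seteqP; rewrite /h; split => M; mx_entries M.
  move=> [b0 adn ac ca c0]; have [c1|c1|c1] := ltgtP c 0.
  - by right; split=> //; lia.
  - by left; split=> //; lia.
  - by rewrite c1 eqxx in c0.
by case=> [] [] *; split=> //; lia.
Qed.

(* The relation [V (S - 1) = (S - 1) V~_n] of Choie and Zagier, modulo the left
   action of [-1] and [(1, 1; 0, 1)]. *)
Lemma hecke_Vtilde (V : comNzRingType) (n : nat) (g : int -> int -> int -> int -> V) :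
  (0 < n)%N ->
  (forall a b c d j, a * d - b * c = n%:Z -> g (a + j * c) (b + j * d) c d = g a b c d) ->
  (forall a b c d, a * d - b * c = n%:Z -> g (- a) (- b) (- c) (- d) = g a b c d) ->
  let D a b c d := g (- c) (- d) a b - g a b c d in
  \sum_(M \in Vtilde_set1 n) (D (M 0 0) (M 0 1) (M 1 0) (M 1 1) +
                              D (M 0 0) (- M 0 1) (- M 1 0) (M 1 1)) +
  \sum_(M \in Vtilde_set2 n) D (M 0 0) (M 0 1) (M 1 0) (M 1 1) +
  \sum_(M \in Vtilde_set3 n) D (M 0 0) (M 0 1) (M 1 0) (M 1 1) =
  \sum_(p <- hecke_reps n) (g p.2 (- (n %/ p.1)%N%:Z) p.1 0 -
                            g (n %/ p.1)%N p.2 0 p.1).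
Proof.
move=> n0 gU gN D.
have f1 := finite_Vtilde_set1 n.
have f2 := finite_Vtilde_set2 n0.
have f3 := finite_Vtilde_set3 n0.
(* The Euclidean exchange is used twice: for [g] with the midpoint, and without it for [g'], which
   is [g] after conjugation by $\mathrm{diag}(1,-1)$. *)
have E1 := euclid_sum n0 (e := 1) isT gU.
pose g' a b c d := g a (- b) (- c) d.
have g'U a b c d j : a * d - b * c = n%:Z -> g' (a + j * c) (b + j * d) c d = g' a b c d.
  move=> E; rewrite /g' -(gU a (- b) (- c) d (- j)); first by congr g; ring.
  by rewrite -E; ring.
have E0 := euclid_sum n0 (e := 0) isT g'U.
have S2 := sum_Vtilde_set2 n0 gU.
have S3 := sum_Vtilde_set3 n0 gU.
have X2 := sum_Vtilde_set2_split
  (fun M : 'M[int]_2 => g (- M 1 0) (- M 1 1) (M 0 0) (M 0 1)) n0.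
have X3 := sum_Vtilde_set3_split
  (fun M : 'M[int]_2 => g (M 0 0) (M 0 1) (M 1 0) (M 1 1)) n0.
have fsplit (P : set 'M[int]_2) (F G : 'M[int]_2 -> V) : finite_set P ->
    \sum_(M \in P) (F M - G M) = \sum_(M \in P) F M - \sum_(M \in P) G M.
  move=> fP; apply/eqP; rewrite eq_sym subr_eq -(fsbig_split _ _ _ fP)/=.
  by apply/eqP; apply: eq_fsbigr => M _; rewrite subrK.
pose S1 (F : int -> int -> int -> int -> V) :=
  \sum_(M \in Vtilde_set1 n) F (M 0 0) (M 0 1) (M 1 0) (M 1 1).
(* This is [E0] expressed through [g]; invariance under $-1$ restores the signs. *)
have A1 : S1 (fun a b c d => g (- c) (- d) a b) +
    \sum_(M \in upper_pos n 0) g 0 (- M 1 1) (M 0 0) (- M 0 1) =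
  S1 (fun a b c d => g a (- b) (- c) d) +
    \sum_(M \in lower_pos n 0) g (M 0 0) 0 (- M 1 0) (M 1 1).
  transitivity (\sum_(M \in Vtilde_set1 n) g' (M 1 0) (- M 1 1) (M 0 0) (- M 0 1) +
    \sum_(M \in upper_pos n 0) g' 0 (- M 1 1) (M 0 0) (M 0 1)).
    congr (_ + _); apply: eq_fsbigr => M /set_mem; rewrite /g'.
      move=> [det_n _ _ _ _]; rewrite -gN ?opprK//.
      by rewrite -det_n; ring.
    move=> [_ ad _ _]; rewrite -[RHS]gN ?oppr0 ?opprK// mul0r sub0r mulrN opprK.
    by rewrite mulrC.
  rewrite E0; congr (_ + _); apply: eq_fsbigr => M /set_mem [b0 _ _ _].
  by rewrite /g' b0 oppr0.
have A2 : \sum_(M \in Vtilde_set2 n) g (- M 1 0) (- M 1 1) (M 0 0) (M 0 1) =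
    \sum_(M \in upper_pos n 1) g 0 (- M 1 1) (M 0 0) (M 0 1) +
    \sum_(M \in diag_pos n) g (- M 1 0) (- M 1 1) (M 0 0) (M 0 1) +
    \sum_(M \in upper_pos n 0) g 0 (- M 1 1) (M 0 0) (- M 0 1).
  rewrite X2; congr (_ + _ + _); apply: eq_fsbigr => M /set_mem [c0 _ _ _];
  by rewrite ?mx22E c0 oppr0.
have A3 : \sum_(M \in Vtilde_set3 n) g (M 0 0) (M 0 1) (M 1 0) (M 1 1) =
    \sum_(M \in lower_pos n 1) g (M 0 0) (M 0 1) (M 1 0) (M 1 1) +
    \sum_(M \in lower_pos n 0) g (M 0 0) 0 (- M 1 0) (M 1 1).
  rewrite X3; congr (_ + _); apply: eq_fsbigr => M /set_mem [b0 _ _ _];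
  by rewrite ?mx22E b0.
have -> : \sum_(M \in Vtilde_set1 n) (D (M 0 0) (M 0 1) (M 1 0) (M 1 1) +
      D (M 0 0) (- M 0 1) (- M 1 0) (M 1 1)) =
    S1 (fun a b c d => g (- c) (- d) a b) - S1 g +
    (S1 (fun a b c d => g c (- d) a (- b)) - S1 (fun a b c d => g a (- b) (- c) d)).
  rewrite /S1 -!fsplit// -(fsbig_split _ _ _ f1).
  by apply: eq_fsbigr => M _ /=; rewrite /D !opprK.
rewrite (fsplit _ _ _ f2) (fsplit _ _ _ f3) sumrB -S2 -S3 A2 A3.
move: E1 A1; rewrite -/(S1 g) -/(S1 (fun a b c d => g c (- d) a (- b))).
move=> /(canRL (addrK _)) -> /(canRL (addrK _)) ->.
by ring.
Qed.

(** * The period function for T *)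

Definition periodic_HC (R : realType) (f : R[i] -> R[i] -> R[i]) : Prop :=
  forall tau z : R[i], upper_half_plane tau ->
    f (tau + 1) z = f tau z /\ f tau (z + 1) = f tau z.

Lemma uhpD_int (R : realType) (tau : R[i]) (j : int) :
  upper_half_plane tau -> upper_half_plane (tau + j%:~R).
Proof.
by rewrite -real_complex_int; case: tau => u v; rewrite /upper_half_plane /= addr0.
Qed.

Lemma periodic_int (R : realType) (f : R[i] -> R[i] -> R[i]) (tau z : R[i]) (i j : int) :
  periodic_HC f -> upper_half_plane tau -> f (tau + i%:~R) (z + j%:~R) = f tau z.
Proof.
move=> fP.
have P1 (n : nat) t w : upper_half_plane t -> f (t + n%:R) w = f t w.
  elim: n t => [|n IH] t tH; first by rewrite addr0.
  by rewrite -addn1 natrD addrA (fP _ _ (uhpD_int n tH)).1 IH.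
have P2 (n : nat) t w : upper_half_plane t -> f t (w + n%:R) = f t w.
  move=> tH; elim: n w => [|n IH] w; first by rewrite addr0.
  by rewrite -addn1 natrD addrA (fP _ _ tH).2 IH.
have P1i t w k : upper_half_plane t -> f (t + k%:~R) w = f t w.
  move=> tH; case: (intP k) => [|n|n]; first by rewrite addr0.
    exact: P1.
  by rewrite -(P1 n.+1); [rewrite mulrNz subrK|exact: uhpD_int].
move=> tH; rewrite P1i//; case: (intP j) => [|n|n]; first by rewrite addr0.
  exact: P2.
by rewrite -[LHS](P2 n.+1)// mulrNz subrK.
Qed.

Definition affine_pull (R : realType) (a b d : nat) (f : R[i] -> R[i] -> R[i])
  (tau z : R[i]) : R[i] := f ((a%:R * tau + b%:R) / d%:R) (a%:R * z).

Lemma int_jslash_hecke_mx (R : realType) (k : int) (m : R[i]) (n : nat) p f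
    (tau z : R[i]) : (0 < n)%N -> p \in hecke_reps n ->
  int_jslash k m n%:R (hecke_mx n p) 0 f tau z =
  p.1%:R ^ (- k) * affine_pull (n %/ p.1)%N p.2 p.1 f tau z.
Proof.
move=> n0; case: p => d b; rewrite mem_hecke_reps//= => /andP[dn bd].
rewrite int_jslash_trig !mx22E//=; congr (_ * f _ _).
have d0 : d%:R != 0 :> R[i] by rewrite pnatr_eq0; lia.
by rewrite -[in LHS](divnK dn) natrM; field.
Qed.

Lemma Vinfty_affine_pull (R : realType) (k : int) (n : nat) f (tau z : R[i]) :
  Vinfty k n f tau z = n%:R ^ (k - 1) * \sum_(p <- hecke_reps n)
    p.1%:R ^ (- k) * affine_pull (n %/ p.1)%N p.2 p.1 f tau z.
Proof.
by rewrite /Vinfty -(big_hecke_reps n (fun d b => d%:R ^ (- k) *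
  affine_pull (n %/ d)%N b d f tau z)).
Qed.

(** The index [m] is a free parameter on the right, since the exponential factor of a triangular
    matrix with zero vector is trivial. *)
Lemma VinftyE (R : realType) (k : int) (n : nat) m f (tau z : R[i]) : (0 < n)%N ->
  Vinfty k n f tau z = n%:R ^ (k - 1) *
    \sum_(p <- hecke_reps n) int_jslash k m n%:R (hecke_mx n p) 0 f tau z.
Proof.
move=> n0; rewrite Vinfty_affine_pull; congr (_ * _).
by rewrite !big_seq; apply: eq_bigr => p pn; rewrite int_jslash_hecke_mx.
Qed.

Lemma int_jslashB (R : realType) (k : int) (m l : R[i]) M X f g (tau z : R[i]) :
  int_jslash k m l M X (fun t w => f t w - g t w) tau z =
  int_jslash k m l M X f tau z - int_jslash k m l M X g tau z.
Proof. by rewrite /int_jslash /jslash mulrBr. Qed.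

Lemma int_jslashZ (R : realType) (k : int) (m l : R[i]) M X a f (tau z : R[i]) :
  int_jslash k m l M X (fun t w => a * f t w) tau z =
  a * int_jslash k m l M X f tau z.
Proof. by rewrite /int_jslash /jslash mulrCA. Qed.

Lemma int_jslash_sum (R : realType) (k : int) (m l : R[i]) M X I (r : seq I) f
    (tau z : R[i]) :
  int_jslash k m l M X (fun t w => \sum_(i <- r) f i t w) tau z =
  \sum_(i <- r) int_jslash k m l M X (f i) tau z.
Proof. by rewrite /int_jslash /jslash mulr_sumr. Qed.

Lemma slash1_Vinfty (R : realType) (k m : int) (n : nat) f M X (tau z : R[i]) :
  (0 < n)%N -> \det M = 1 -> upper_half_plane tau ->
  slash1 k (m * n%:Z) (int_elt R M X) (Vinfty k n f) tau z =
  n%:R ^ (k - 1) * \sum_(p <- hecke_reps n)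
    int_jslash k (m%:~R * n%:R) n%:R (hecke_mx n p *m M) X f tau z.
Proof.
move=> n0 dM tH; rewrite slash1_int_elt intrM.
rewrite (@eq_int_jslash _ _ _ _ _ _ _ (fun t w => n%:R ^ (k - 1) *
    \sum_(p <- hecke_reps n)
       int_jslash k (m%:~R * n%:R) n%:R (hecke_mx n p) 0 f t w)) ?dM//; last first.
  by move=> t w _; exact: VinftyE.
rewrite int_jslashZ int_jslash_sum; congr (_ * _).
rewrite !big_seq; apply: eq_bigr => p; rewrite mem_hecke_reps// => /andP[pn _].
by rewrite int_jslash_comp_left// det_hecke_mx.
Qed.

Definition mxS : 'M[int]_2 := mx22 0 (-1) 1 0.

(** As $(0,1)S=(1,0)$, the element $T$ factors as $[I,(0,1)][S,(0,0)]$, and the first factor acts by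
    $z\mapsto z+1$. *)
Lemma slash1_eltT (R : realType) (k m : int) f (tau z : R[i]) :
  (forall t w, upper_half_plane t -> f t (w + 1) = f t w) -> upper_half_plane tau ->
  slash1 k m (eltT R) f tau z = int_jslash k m%:~R 1 mxS 0 f tau z.
Proof.
move=> fP tH; rewrite slash1_int_elt.
have dS : \det mxS = 1 by rewrite det_mx22 !mx22E.
have := @int_jslash_comp_right R k m%:~R 1 1%:M (rv2 0 1) mxS (rv2 1 0) f tau z tH
  (det1 _ _) isT dS.
rewrite mul1mx mulr1 => <-; last first.
  by apply/rowP => j; rewrite mulmx22E !mxE /= mul0r add0r.
rewrite [RHS](@eq_int_jslash _ _ _ _ _ _ _
  (int_jslash k m%:~R 1 1%:M (rv2 0 1) f)) ?dS//.
move=> t w /= uH; rewrite /int_jslash /jslash !mxE /= !mul0r !mul1r !mulr0.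
rewrite !(mul0r, mul1r, mulr0, mulr1, add0r, addr0, oppr0, invr1, divr1).
by rewrite mulr0z mulr1z expr0n /= mul0r mulr0 cexp0 exp1rz !mul1r fP.
Qed.

Lemma int_jslash_translate (R : realType) (k m : int) (n : nat) f (tau z : R[i])
    (M : 'M[int]_2) (j : int) :
  periodic_HC f -> (0 < n)%N -> \det M = n%:Z -> upper_half_plane tau ->
  int_jslash k (m%:~R * n%:R) n%:R (mx22 1 j 0 1 *m M) 0 f tau z =
  int_jslash k (m%:~R * n%:R) n%:R M 0 f tau z.
Proof.
move=> fP n0 dM tH.
rewrite -(@int_jslash_comp_right R k m%:~R n (mx22 1 j 0 1) 0 M 0)//; last 2 first.
- by rewrite det_mx22 !mx22E mulr1 mulr0 subr0.
- by rewrite mul0mx scaler0.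
apply: eq_int_jslash; rewrite ?dM// => t w uH.
rewrite int_jslash_trig !mx22E//= exp1rz !mul1r !divr1.
by rewrite -[in RHS](periodic_int w j 0 fP uH) addr0.
Qed.

Lemma int_jslash_opp (R : realType) (k m : int) (n : nat) f (tau z : R[i])
    (M : 'M[int]_2) :
  N1_invariant k m f -> (0 < n)%N -> \det M = n%:Z -> upper_half_plane tau ->
  int_jslash k (m%:~R * n%:R) n%:R (- M) 0 f tau z =
  int_jslash k (m%:~R * n%:R) n%:R M 0 f tau z.
Proof.
move=> fN n0 dM tH; rewrite -[- M]mul1mx mulmxN -mulNmx.
rewrite -(@int_jslash_comp_right R k m%:~R n (- 1%:M) 0 M 0)//; last 2 first.
- by rewrite det_mx22 !mxE.
- by rewrite mul0mx scaler0.
apply: eq_int_jslash; rewrite ?dM// => t w uH.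
by rewrite -slash1_int_elt fN.
Qed.

Lemma affine_div (R : realType) (a b d : nat) (u v : R) : (0 < d)%N ->
  (a%:R * (u +i* v) + b%:R) / d%:R =
  (a%:R / d%:R * u + b%:R / d%:R) +i* (a%:R / d%:R * v).
Proof.
move=> d0; have dR : d%:R != 0 :> R by rewrite pnatr_eq0 -lt0n.
have dC : d%:R != 0 :> R[i] by rewrite pnatr_eq0 -lt0n.
rewrite -affineE !(rmorphM (real_complex R)) /= !fmorphV /= !rmorph_nat.
by field.
Qed.

Lemma affine_uhp (R : realType) (a b d : nat) (tau : R[i]) :
  (0 < a)%N -> (0 < d)%N -> upper_half_plane tau ->
  upper_half_plane ((a%:R * tau + b%:R) / d%:R).
Proof.
case: tau => u v a0 d0; rewrite /upper_half_plane affine_div//= => v0.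
by rewrite mulr_gt0// divr_gt0// ltr0n.
Qed.

(** Passing to $\tau+1$ replaces $b$ by $b+a$ with $a=n/d$, which permutes the residues modulo $d$;
    passing to $z+1$ shifts $az$ by the integer $a$. *)
Lemma Vinfty_periodic (R : realType) (k : int) (n : nat) (f : R[i] -> R[i] -> R[i]) :
  (0 < n)%N -> periodic_HC f -> periodic_HC (Vinfty k n f).
Proof.
move=> n0 fP tau z tH.
split; congr (_ * _); rewrite !big_seq; apply: eq_bigr => d;
  rewrite -dvdn_divisors// => dn; have d0 := dvdn_gt0 n0 dn;
  have dC : d%:R != 0 :> R[i] by rewrite pnatr_eq0 -lt0n.
  set a := (n %/ d)%N; have a0 : (0 < a)%N by rewrite divn_gt0// dvdn_leq.
  have Ph b : f ((a%:R * tau + (b + d)%:R) / d%:R) (a%:R * z) =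
      f ((a%:R * tau + b%:R) / d%:R) (a%:R * z).
    rewrite natrD addrA mulrDl divff//.
    by rewrite (fP _ _ (affine_uhp b a0 d0 tH)).1.
  have shift (h : nat -> R[i]) : (forall b, h (b + d)%N = h b) ->
      forall c, \sum_(0 <= b < d) h (b + c)%N = \sum_(0 <= b < d) h b.
    move=> hd; elim=> [|c IH]; first by apply: eq_bigr => b _; rewrite addn0.
    rewrite -IH -(prednK d0) big_nat_recr//= big_nat_recl//= addrC.
    congr (_ + _); last by apply: eq_bigr => b _; rewrite addSnnS.
    by rewrite addnS -addSn prednK// addnC hd.
  rewrite -[RHS](shift _ _ a); last by move=> b; rewrite Ph.
  apply: eq_bigr => b _; congr (_ * f (_ / _) _).
  by rewrite natrD; ring.
apply: eq_bigr => b _; congr (_ * _).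
rewrite mulrDr mulr1 -[in RHS](periodic_int _ 0 (n %/ d)%N%:Z fP) ?addr0//.
by apply: affine_uhp => //; rewrite divn_gt0// dvdn_leq.
Qed.

(** At a fixed point $(\tau,z)$ the value of $f|M$, as a function [g] of the entries of $M$, has
    both invariances required by [hecke_Vtilde]: translations by periodicity, the sign by
    [N1_invariant]. *)
Lemma period_function_Vinfty_T (R : realType) (k m : int) (n : nat)
    (f : R[i] -> R[i] -> R[i]) (tau z : R[i]) :
  (0 < n)%N -> periodic_HC f -> N1_invariant k m f -> upper_half_plane tau ->
  period_function k (m * n%:Z) (Vinfty k n f) (eltT R) tau z =
  (n%:R `^ (k%:~R / 2 - 1))%:C *
  slash_Vtilde k m n (period_function k m f (eltT R))
    tau ((Num.sqrt n%:R)%:C * z).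
Proof.
move=> n0 fP fN tH.
have nR : 0 < n%:R :> R by rewrite ltr0n.
pose J (M : 'M[int]_2) := int_jslash k (m%:~R * n%:R) n%:R M 0 f tau z.
pose g a b c d := J (mx22 a b c d).
have gE M : J M = g (M 0 0) (M 0 1) (M 1 0) (M 1 1).
  by congr J; apply: eq_mx22; rewrite !mx22E.
have gU a b c d j : a * d - b * c = n%:Z -> g (a + j * c) (b + j * d) c d = g a b c d.
  move=> D.
  rewrite -[RHS](@int_jslash_translate R k m n f tau z (mx22 a b c d) j fP n0)//; last first.
    by rewrite det_mx22 !mx22E.
  by rewrite -/(J _) gE !mulmx22E !mx22E !mul1r !mul0r !add0r.
have gN a b c d : a * d - b * c = n%:Z -> g (- a) (- b) (- c) (- d) = g a b c d.
  move=> D.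
  rewrite -[RHS](@int_jslash_opp R k m n f tau z (mx22 a b c d) fN n0)//; last first.
    by rewrite det_mx22 !mx22E.
  by rewrite -[RHS]/(J (- mx22 a b c d)) [RHS]gE !mxE.
have fz t w : upper_half_plane t -> f t (w + 1) = f t w by move=> /(fP _ w)[].
pose D a b c d := g (- c) (- d) a b - g a b c d.
(* Since $f|T=f|S$, the function $P_T|M$ is $f|SM-f|M$, up to the factor $n^{k/2}$ of the
   normalisation. *)
have PE M : \det M = n%:Z ->
    slash k m (int_elt R M 0) (period_function k m f (eltT R)) tau
      ((Num.sqrt n%:R)%:C * z) =
    (n%:R `^ (k%:~R / 2))%:C * D (M 0 0) (M 0 1) (M 1 0) (M 1 1).
  move=> dM; rewrite slash_int_elt//; congr (_ * _).
  have dS : \det mxS = 1 by rewrite det_mx22 !mx22E.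
  rewrite (@eq_int_jslash _ _ _ _ _ _ _
    (fun t w => int_jslash k m%:~R 1 mxS 0 f t w - f t w)) ?dM//; last first.
    by move=> t w uH; rewrite /period_function (slash1_eltT k m w fz uH).
  rewrite int_jslashB -/(J M) gE; congr (_ - _).
  rewrite (@int_jslash_comp_right R k m%:~R n mxS 0 M 0)//; last first.
    by rewrite mul0mx scaler0.
  rewrite -/(J _) gE !mulmx22E !mx22E.
  by rewrite !mul0r !mul1r !mulN1r !add0r !addr0.
have SE : slash_Vtilde k m n (period_function k m f (eltT R)) tau
      ((Num.sqrt n%:R)%:C * z) = (n%:R `^ (k%:~R / 2))%:C *
    \sum_(p <- hecke_reps n) (g p.2 (- (n %/ p.1)%N%:Z) p.1 0 -
                              g (n %/ p.1)%N p.2 0 p.1).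
  rewrite -(hecke_Vtilde n0 gU gN) -/D /slash_Vtilde !mulrDr !mulr_fsumr.
  congr (_ + _ + _); apply: eq_fsbigr => M /set_mem [].
  - move=> det_n _ _ _ _; rewrite !PE ?det_mx22 ?mx22E//; first by rewrite -mulrDr.
    by rewrite mulrNN.
  - by move=> c0 det_n _ _; rewrite PE// det_mx22 c0 mulr0 subr0.
  - by move=> b0 det_n _ _ _; rewrite PE// det_mx22 b0 mul0r subr0.
(* The scalars combine as $n^{k/2-1}n^{k/2}=n^{k-1}$, the factor in [Vinfty]. *)
rewrite SE mulrA -rmorphM -powRD; last by rewrite (gt_eqF nR) implybT.
rewrite -addrA (addrC (-1)) addrA -splitr.
have -> : n%:R `^ (k%:~R - 1) = n%:R ^ (k - 1) :> R.
  have -> : k%:~R - 1 = (k - 1)%:~R :> R by rewrite intrB.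
  by rewrite powR_intmul// ltW.
rewrite rmorphXz /= ?unitfE ?gt_eqF// rmorph_nat.
rewrite /period_function (VinftyE _ (m%:~R * n%:R))// slash1_eltT; first last.
- exact: tH.
- by move=> t w uH; case: (Vinfty_periodic k n0 fP w uH).
rewrite -slash1_int_elt slash1_Vinfty//; last by rewrite det_mx22 !mx22E.
rewrite -mulrBr sumrB; congr (_ * (_ - _)).
  rewrite !big_seq; apply: eq_bigr => p _.
  rewrite -/(J _) gE !mulmx22E !mx22E.
  by rewrite !mulr0 !mulr1 !mul0r !mulrN1 !add0r !addr0.
Qed.

(** * Real analytic functions and growth conditions *)

Lemma normr_normc (R : realType) (x : R[i]) : `|x| = (normc x)%:C.
Proof. by case: x => a b; rewrite normc_def. Qed.

Lemma normc_ge0 (R : realType) (x : R[i]) : 0 <= normc x.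
Proof. by case: x => a b; exact: sqrtr_ge0. Qed.

Lemma normc_real (R : realType) (x : R) : normc x%:C = `|x|.
Proof. by rewrite /= expr0n addr0 sqrtr_sqr. Qed.

Lemma ler_normcD (R : realType) (x y : R[i]) : normc (x + y) <= normc x + normc y.
Proof. by rewrite -lecR rmorphD /= -!normr_normc ler_normD. Qed.

(** Each analytic condition cuts out a subspace, so for $f|\mathcal{V}_n^\infty$ and its period
    functions it is enough to treat one affine substitution at a time. *)
Definition linear_closed (R : realType) (P : (R[i] -> R[i] -> R[i]) -> Prop) : Prop :=
  [/\ P (fun _ _ => 0),
      forall f g, P f -> P g -> P (fun t z => f t z + g t z)
    & forall c f, P f -> P (fun t z => c * f t z)].

Lemma linear_closed_sum (R : realType) (P : (R[i] -> R[i] -> R[i]) -> Prop)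
    (I : eqType) (r : seq I) (f : I -> R[i] -> R[i] -> R[i]) :
  linear_closed P -> (forall i, i \in r -> P (f i)) ->
  P (fun t z => \sum_(i <- r) f i t z).
Proof.
move=> [P0 PD _]; elim: r => [|i r IH] Pf.
  by rewrite (_ : (fun _ _ => _) = fun _ _ => 0)//; apply/funext => t;
    apply/funext => z; rewrite big_nil.
rewrite (_ : (fun _ _ => _) = fun t z => f i t z + \sum_(j <- r) f j t z).
  apply: PD; first by apply: Pf; rewrite mem_head.
  by apply: IH => j jr; apply: Pf; rewrite in_cons jr orbT.
by apply/funext => t; apply/funext => z; rewrite big_cons.
Qed.

Lemma real_analytic_at_cst0 (R : realType) (d : nat) (p : 'rV[R]_d) :
  real_analytic_at (fun=> 0) p.
Proof.
exists 1, (fun=> 0); split=> [//|h _]; split.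
  by exists 0 => N; rewrite big1// => al _; rewrite ComplexField.Normc.normc0 mul0r.
rewrite (_ : (fun _ => _) = fun=> 0); first exact: cvg_cst.
by apply/funext => N; rewrite big1// => al _; rewrite mul0r.
Qed.

Lemma cvg_complexD (R : realType) (u v w : nat -> R[i]) (a b c : R[i]) :
  (forall N, w N = u N + v N) -> c = a + b ->
  (u : nat -> R[i]^o) @ \oo --> (a : R[i]^o) ->
  (v : nat -> R[i]^o) @ \oo --> (b : R[i]^o) ->
  (w : nat -> R[i]^o) @ \oo --> (c : R[i]^o).
Proof.
move=> /funext-> -> ua vb; exact: (@cvgD R[i] R[i]^o nat \oo _ u v a b ua vb).
Qed.

Lemma cvg_complexZ (R : realType) (u w : nat -> R[i]) (k a c : R[i]) :
  (forall N, w N = k * u N) -> c = k * a ->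
  (u : nat -> R[i]^o) @ \oo --> (a : R[i]^o) ->
  (w : nat -> R[i]^o) @ \oo --> (c : R[i]^o).
Proof.
by move=> /funext-> -> ua; exact: (@cvgZl_tmp R[i] R[i]^o nat \oo _ k u a ua).
Qed.

Lemma real_analytic_atD (R : realType) (d : nat) (F G : 'rV[R]_d -> R[i]) (p : 'rV[R]_d) :
  real_analytic_at F p -> real_analytic_at G p ->
  real_analytic_at (fun q => F q + G q) p.
Proof.
move=> [r [cF [r0 HF]]] [s [cG [s0 HG]]].
exists (Num.min r s), (fun al => cF al + cG al).
split=> [|h hrs]; first by rewrite lt_min r0.
have [|[B FB] Fc] := HF h.
  by move=> i; apply: lt_le_trans (hrs i) _; rewrite ge_min lexx.
have [|[C GC] Gc] := HG h.
  by move=> i; apply: lt_le_trans (hrs i) _; rewrite ge_min lexx orbT.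
split.
  exists (B + C) => N; apply: le_trans (lerD (FB N) (GC N)); rewrite -big_split /=.
  apply: ler_sum => al _; rewrite -mulrDl ler_wpM2r ?ler_normcD//.
  by apply: prodr_ge0 => i _; rewrite exprn_ge0.
apply: (cvg_complexD _ erefl Fc Gc) => N.
by rewrite -big_split; apply: eq_bigr => al _; rewrite mulrDl.
Qed.

Lemma real_analytic_atZ (R : realType) (d : nat) c (F : 'rV[R]_d -> R[i]) (p : 'rV[R]_d) :
  real_analytic_at F p -> real_analytic_at (fun q => c * F q) p.
Proof.
move=> [r [cF [r0 HF]]].
exists r, (fun al => c * cF al); split=> [//|h /HF[[B FB] Fc]]; split.
  exists (normc c * B) => N; apply: le_trans (ler_wpM2l (normc_ge0 c) (FB N)).
  rewrite mulr_sumr; apply: ler_sum => al _.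
  by rewrite ComplexField.Normc.normcM mulrA.
apply: (cvg_complexZ _ erefl Fc) => N.
by rewrite mulr_sumr; apply: eq_bigr => al _; rewrite mulrA.
Qed.

(** Rescaling the coordinates multiplies the coefficient of multi-index $\alpha$ by $s^\alpha$ and
    shrinks the radius. *)
Lemma real_analytic_at_comp_diag (R : realType) (d : nat) (F : 'rV[R]_d -> R[i])
    (s t p : 'rV[R]_d) :
  (forall i, 0 < s 0 i) ->
  real_analytic_at F (\row_i (s 0 i * p 0 i + t 0 i)) ->
  real_analytic_at (fun q => F (\row_i (s 0 i * q 0 i + t 0 i))) p.
Proof.
move=> s0 [r [cF [r0 HF]]].
(* [S] bounds every scale, so increments below [r / S] are scaled to increments below [r]; the
   summand 1 keeps [S] positive even for [d = 0]. *)
pose S := 1 + \sum_i s 0 i.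
have S0 : 0 < S by rewrite ltr_wpDr// sumr_ge0// => i _; rewrite ltW.
have sS i : s 0 i <= S.
  rewrite /S (bigD1 i)//= addrCA lerDl addr_ge0//.
  by apply: sumr_ge0 => j _; rewrite ltW.
exists (r / S), (fun al => cF al * (\prod_i s 0 i ^+ al i)%:C).
split=> [|h hr]; first by rewrite divr_gt0.
have [|[B FB] Fc] := HF (\row_i (s 0 i * h 0 i)).
  move=> i; rewrite mxE normrM gtr0_norm//.
  have := hr i; rewrite ltr_pdivlMr// mulrC; apply: le_lt_trans.
  by rewrite ler_wpM2r.
split.
  exists B => N; apply: le_trans (FB N); apply: ler_sum => al _.
  rewrite ComplexField.Normc.normcM normc_real -mulrA ger0_norm; last first.
    by apply: prodr_ge0 => i _; rewrite exprn_ge0// ltW.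
  rewrite -big_split /=; apply: ler_wpM2l; first exact: normc_ge0.
  by apply: ler_prod => i _; rewrite !ffunE !mxE normrM exprMn (gtr0_norm (s0 i)) lexx
    mulr_ge0// exprn_ge0// ltW.
have -> : \row_i (s 0 i * (p + h) 0 i + t 0 i) =
    \row_i (s 0 i * p 0 i + t 0 i) + \row_i (s 0 i * h 0 i).
  by apply/rowP => i; rewrite !mxE; ring.
apply: cvg_trans Fc; apply: near_eq_cvg; near=> N.
apply: eq_bigr => al _; rewrite -mulrA -rmorphM -big_split /=; congr (_ * _%:C).
by apply: eq_bigr => i _; rewrite !ffunE !mxE exprMn.
Unshelve. all: by end_near. Qed.

Lemma real_analytic_HC_linear (R : realType) : linear_closed (@real_analytic_HC R).
Proof.
split=> [p _|f g Hf Hg p p0|c f Hf p p0].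
- exact: real_analytic_at_cst0.
- exact: real_analytic_atD (Hf p p0) (Hg p p0).
- exact: real_analytic_atZ (Hf p p0).
Qed.

Lemma natr_complex (R : realType) (a : nat) (x y : R) :
  a%:R * (x +i* y) = (a%:R * x) +i* (a%:R * y).
Proof.
rewrite -(rmorph_nat (real_complex R)).
by rewrite -[LHS]addr0 -(rmorph0 (real_complex R)) affineE addr0.
Qed.

Lemma real_analytic_HC_pull (R : realType) (a b d : nat) (f : R[i] -> R[i] -> R[i]) :
  (0 < a)%N -> (0 < d)%N ->
  real_analytic_HC f -> real_analytic_HC (affine_pull a b d f).
Proof.
move=> a0 d0 Hf p p1.
pose s : 'rV[R]_4 := \row_i (if (i < 2)%N then a%:R / d%:R else a%:R).
pose t : 'rV[R]_4 := \row_i (if i == 0%N :> nat then b%:R / d%:R else 0).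
have E q : real_coords (affine_pull a b d f) q =
    real_coords f (\row_i (s 0 i * q 0 i + t 0 i)).
  rewrite /real_coords /affine_pull affine_div// !mxE !inordK//= !addr0.
  by rewrite natr_complex.
rewrite (funext E); apply: real_analytic_at_comp_diag => [i|].
  by rewrite mxE; case: ifP; rewrite ?divr_gt0// ltr0n.
apply: Hf; rewrite !mxE !inordK//= addr0 mulr_gt0//.
by rewrite divr_gt0// ltr0n.
Qed.

(** * Behaviour as $v$ and $y$ tend to infinity *)

Definition vanishing_at_infinity (R : realType) (k m : int) (f : R[i] -> R[i] -> R[i]) :=
  forall eps : R, 0 < eps -> exists A : R,
    forall tau z : R[i], upper_half_plane tau ->
      let v := complex.Im tau in let y := complex.Im z in
      A < v -> A < y ->
      normc (f tau z) * v `^ (- k%:~R / 2) *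
        expR (- (2 * pi * m%:~R * y ^+ 2 / v)) < eps.

Lemma vanishing_linear (R : realType) (k m : int) :
  linear_closed (@vanishing_at_infinity R k m).
Proof.
split=> [e e0|f g Hf Hg e e0|c f Hf e e0].
- by exists 0 => tau z _ v y _ _; rewrite ComplexField.Normc.normc0 !mul0r.
- have e20 : 0 < e / 2 by rewrite divr_gt0.
  have [A FA] := Hf _ e20; have [B GB] := Hg _ e20.
  exists (Num.max A B) => tau z tH /=; rewrite !gt_max => /andP[Av Bv] /andP[Ay By].
  rewrite [e]splitr; apply: le_lt_trans (ltrD (FA _ _ tH Av Ay) (GB _ _ tH Bv By)).
  rewrite -!mulrDl -!mulrA ler_wpM2r ?ler_normcD//.
  by rewrite mulr_ge0// ?powR_ge0// expR_ge0.
- have c0 : 0 < normc c + 1 by rewrite ltr_wpDl// normc_ge0.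
  have [A FA] := Hf _ (divr_gt0 e0 c0).
  exists A => tau z tH /= Av Ay; rewrite ComplexField.Normc.normcM -2!(mulrA (normc c)).
  have := FA _ _ tH Av Ay; rewrite /= ltr_pdivlMr// [ltLHS]mulrC; apply: le_lt_trans.
  apply: ler_wpM2r; last by rewrite lerDl.
  by rewrite !mulr_ge0// ?normc_ge0// ?powR_ge0// expR_ge0.
Qed.

(** Replacing $(v,y)$ by $(av/d,ay)$ turns $my^2/v$ into $m\,ad\,y^2/v$, hence the new index; the
    power of $v$ changes by a constant only. *)
Lemma vanishing_pull (R : realType) (k m : int) (a b d : nat) (f : R[i] -> R[i] -> R[i]) :
  (0 < a)%N -> (0 < d)%N -> vanishing_at_infinity k m f ->
  vanishing_at_infinity k (m * (a * d)%N%:Z) (affine_pull a b d f).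
Proof.
move=> a0 d0 Hf e e0.
have aR : 0 < a%:R :> R by rewrite ltr0n.
have dR : 0 < d%:R :> R by rewrite ltr0n.
pose c : R := (d%:R / a%:R) `^ (- k%:~R / 2).
have c0 : 0 < c by rewrite powR_gt0// divr_gt0.
have [A FA] := Hf _ (divr_gt0 e0 c0).
(* As [a] and [d] are at least 1, beyond this threshold both $av/d$ and $ay$ exceed [A]. *)
exists (`|A| * d%:R) => -[u v] [x y] tH /= Av Ay.
have v0 : 0 < v := tH.
have a1 : 1 <= a%:R :> R by rewrite ler1n.
have d1 : 1 <= d%:R :> R by rewrite ler1n.
have Av' : A < a%:R / d%:R * v.
  apply: le_lt_trans (ler_norm A) _; rewrite mulrAC ltr_pdivlMr//.
  by apply: lt_le_trans Av _; rewrite ler_peMl// ltW.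
have Ay' : A < a%:R * y.
  have y0 : `|A| < y by apply: le_lt_trans Ay; rewrite ler_peMr.
  apply: le_lt_trans (ler_norm A) _; apply: lt_le_trans (y0) _.
  by rewrite ler_peMl// (le_trans (normr_ge0 A))// ltW.
have := FA _ _ (affine_uhp b a0 d0 tH); rewrite /= => /(_ (a%:R * (x +i* y))).
rewrite /affine_pull affine_div//= natr_complex /= => /(_ Av' Ay').
rewrite ltr_pdivlMr//; apply: le_lt_trans.
have -> : 2 * pi * (m * (a * d)%N%:Z)%:~R * y ^+ 2 / v =
   2 * pi * m%:~R * (a%:R * y) ^+ 2 / (a%:R / d%:R * v).
  by rewrite intrM PoszM intrM; field; rewrite ?gt_eqF.
rewrite [leRHS]mulrAC ler_wpM2r ?expR_ge0// -(mulrA (normc _)) ler_wpM2l ?normc_ge0//.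
have w0 : 0 <= a%:R / d%:R * v by rewrite !mulr_ge0 ?invr_ge0 ?ltW.
have q0 : 0 <= d%:R / a%:R :> R by rewrite mulr_ge0 ?invr_ge0 ?ltW.
rewrite /c -powRM// (_ : a%:R / d%:R * v * (d%:R / a%:R) = v)//.
by field; rewrite ?gt_eqF.
Qed.

(** * Holomorphy over the half plane *)

Lemma near_uhp (R : realType) (tau z : R[i]) : upper_half_plane tau ->
  \forall p \near nbhs ((tau, z) : (R[i]^o * R[i]^o)%type), upper_half_plane p.1.
Proof.
move=> tH.
have H : \forall t \near nbhs (tau : R[i]^o), upper_half_plane t.
  (* The disc of radius $\mathrm{Im}\,\tau$ around $\tau$ stays in the half plane. *)
  apply: (@nbhs_norm_le_nbhs R[i] R[i]^o); exists (complex.Im tau)%:C.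
    by rewrite /= ltcR.
  move=> t /=; rewrite normr_normc ltcR /upper_half_plane /= => h.
  have : `|complex.Im (tau - t)| <= normc (tau - t).
    case: (tau - t) => x y /=; rewrite -sqrtr_sqr ler_wsqrtr// lerDr sqr_ge0//.
  move=> /le_lt_trans/(_ h); rewrite raddfB /= ltr_norml => /andP[_].
  by rewrite ltrBlDr ltrDl.
exact: (@cvg_fst R[i]^o R[i]^o (nbhs (tau : R[i]^o)) (nbhs (z : R[i]^o)) _ _ H).
Qed.

Lemma holomorphic_HC_ext (R : realType) (f g : R[i] -> R[i] -> R[i]) :
  (forall t w, upper_half_plane t -> f t w = g t w) ->
  holomorphic_HC g -> holomorphic_HC f.
Proof.
move=> fg Hg tau z tH; apply: near_differentiable (Hg tau z tH).
by apply: filterS (near_uhp z tH) => p; exact: fg.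
Qed.

Lemma holomorphic_HC_linear (R : realType) : linear_closed (@holomorphic_HC R).
Proof.
split=> [tau z _|f g Hf Hg tau z tH|c f Hf tau z tH].
- exact: (@differentiable_cst R[i] _ R[i]^o 0).
- exact: (differentiableD (Hf _ _ tH) (Hg _ _ tH)).
- exact: (differentiableZ c (Hf _ _ tH)).
Qed.

Lemma holomorphic_HC_pull (R : realType) (a b d : nat) (f : R[i] -> R[i] -> R[i]) :
  (0 < a)%N -> (0 < d)%N -> holomorphic_HC f -> holomorphic_HC (affine_pull a b d f).
Proof.
move=> a0 d0 Hf tau z tH.
pose T : normedModType R[i] := (R[i]^o * R[i]^o)%type.
have Dfst (p : T) : differentiable (fst : T -> R[i]^o) p.
  by apply: linear_differentiable => q; exact: cvg_fst.
have Dsnd (p : T) : differentiable (snd : T -> R[i]^o) p.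
  by apply: linear_differentiable => q; exact: cvg_snd.
pose h1 : T -> R[i]^o :=
  (a%:R / d%:R : R[i]) *: (fst : T -> R[i]^o) + cst (b%:R / d%:R : R[i]^o).
pose h2 : T -> R[i]^o := (a%:R : R[i]) *: (snd : T -> R[i]^o).
have Dh1 (p : T) : differentiable h1 p.
  by apply: differentiableD; [exact: differentiableZ|exact: differentiable_cst].
have Dh2 (p : T) : differentiable h2 p by exact: differentiableZ.
have h1E p : h1 p = (a%:R * p.1 + b%:R) / d%:R.
  by rewrite mulrDl mulrAC.
pose F : T -> R[i]^o := fun p => f p.1 p.2.
have := @differentiable_comp R[i] T T R[i]^o (fun p => (h1 p, h2 p)) F (tau, z)
  (differentiable_pair (Dh1 _) (Dh2 _)).
rewrite h1E => /(_ (Hf _ _ (affine_uhp b a0 d0 tH))).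
rewrite (_ : F \o _ = fun p => affine_pull a b d f p.1 p.2)//.
by apply/funext => p; rewrite /F /= h1E.
Qed.

(** * Growth bounds for period functions *)

Lemma powR_sum_ge1 (R : realType) (x v rho sigma : R) :
  0 < v <= x -> 0 < rho -> 0 < sigma -> 1 <= x `^ rho + v `^ (- sigma).
Proof.
have p1 r : 1 `^ r = 1 :> R by rewrite powR1.
move=> /andP[v0 vx] r0 s0; have [x1|x1] := leP 1 x.
  apply: ler_wpDr; first exact: powR_ge0.
  rewrite -(p1 rho); apply: ge0_ler_powR; rewrite ?nnegrE ?ler01// ?ltW//.
  exact: lt_le_trans x1.
apply: ler_wpDl; first exact: powR_ge0.
rewrite powRN invf_ge1 ?powR_gt0// -[leRHS](p1 sigma).
by apply: ge0_ler_powR; rewrite ?nnegrE ?ler01// ltW// (le_lt_trans vx).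
Qed.

Lemma powR_le1D (R : realType) (x r s : R) : 0 <= x -> 0 <= r <= s ->
  x `^ r <= 1 + x `^ s.
Proof.
have p1 t : 1 `^ t = 1 :> R by rewrite powR1.
move=> x0 /andP[r0 rs]; have [x1|x1] := leP 1 x.
  by apply: ler_wpDl => //; exact: ler_powR.
apply: ler_wpDr; first exact: powR_ge0.
by rewrite -(p1 r); apply: ge0_ler_powR; rewrite ?nnegrE ?ler01// ltW.
Qed.

(** Enlarging an exponent costs at most 1 per term, by [powR_le1D] applied to $x$ and $v^{-1}$; the
    total excess 2 is absorbed because the right-hand sum is at least 1. *)
Lemma powR_sum_le (R : realType) (x v r1 s1 r2 s2 : R) :
  0 < v <= x -> 0 < r1 <= r2 -> 0 < s1 <= s2 ->
  x `^ r1 + v `^ (- s1) <= 3 * (x `^ r2 + v `^ (- s2)).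
Proof.
move=> vx /andP[r1p r12] /andP[s1p s12].
have := powR_sum_ge1 vx (lt_le_trans r1p r12) (lt_le_trans s1p s12).
have /andP[v0 vx'] := vx.
have := @powR_le1D _ x r1 r2 (ltW (lt_le_trans v0 vx')).
rewrite r12 (ltW r1p) => /(_ isT).
have := @powR_le1D _ v^-1 s1 s2; rewrite invr_ge0 (ltW v0) s12 (ltW s1p) => /(_ isT isT).
rewrite -!powR_inv1 ?(ltW v0)// -!powRrM !mulN1r; lra.
Qed.

Definition moderate_growth (R : realType) (m : int) (g : R[i] -> R[i] -> R[i]) : Prop :=
  exists K rho sigma : R, [/\ 0 < K, 0 < rho, 0 < sigma &
    forall tau z : R[i], upper_half_plane tau ->
      let v := complex.Im tau in let y := complex.Im z in
      normc (g tau z) <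
        K * (normc tau `^ rho + v `^ (- sigma)) *
        expR (2 * pi * m%:~R * y ^+ 2 / v)].

Lemma uhp_Im_normc (R : realType) (tau : R[i]) : upper_half_plane tau ->
  0 < complex.Im tau <= normc tau.
Proof.
rewrite /upper_half_plane /= => v0; rewrite v0 /=; case: tau v0 => u v /= v0.
by rewrite -[leLHS]gtr0_norm// -sqrtr_sqr ler_wsqrtr// lerDr sqr_ge0.
Qed.

Lemma moderate_growth_linear (R : realType) (m : int) :
  linear_closed (@moderate_growth R m).
Proof.
split=> [|f g [K1 [r1 [s1 [K10 r10 s10 H1]]]] [K2 [r2 [s2 [K20 r20 s20 H2]]]]
    |c f [K [r [s [K0 r0 s0 H]]]]].
- exists 1, 1, 1; split=> // tau z tH; rewrite ComplexField.Normc.normc0 /= mul1r.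
  rewrite mulr_gt0 ?expR_gt0//; have vx := uhp_Im_normc tH.
  by apply: lt_le_trans (powR_sum_ge1 vx _ _).
- exists (3 * (K1 + K2)), (Num.max r1 r2), (Num.max s1 s2).
  split; rewrite ?lt_max ?r10 ?s10 ?mulr_gt0 ?addr_gt0// => tau z tH /=.
  have vx := uhp_Im_normc tH.
  apply: le_lt_trans (ler_normcD _ _) _.
  apply: lt_le_trans (ltrD (H1 _ _ tH) (H2 _ _ tH)) _ => /=.
  rewrite -mulrDl ler_wpM2r ?expR_ge0// (mulrC 3) -mulrA mulrDl.
  apply: lerD; rewrite ler_pM2l//; apply: powR_sum_le => //.
  + by rewrite r10 le_max lexx.
  + by rewrite s10 le_max lexx.
  + by rewrite r20 le_max lexx orbT.
  + by rewrite s20 le_max lexx orbT.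
- have c0 : 0 < normc c + 1 by rewrite ltr_wpDl// normc_ge0.
  exists ((normc c + 1) * K), r, s; split=> // [|tau z tH /=]; first exact: mulr_gt0.
  rewrite ComplexField.Normc.normcM -2!(mulrA (_ + 1)).
  apply: le_lt_trans (_ : (normc c + 1) * normc (f tau z) < _).
    by rewrite ler_wpM2r ?normc_ge0// lerDl.
  by rewrite ltr_pM2l//; exact: H.
Qed.

Lemma normc_affine_le (R : realType) (a b d : nat) (tau : R[i]) : (0 < d)%N ->
  normc ((a%:R * tau + b%:R) / d%:R) <= (a + b)%:R * (normc tau + 1).
Proof.
move=> d0; have d1 : 1 <= d%:R :> R by rewrite ler1n.
have nn (k : nat) : normc (k%:R : R[i]) = k%:R.
  by rewrite -(rmorph_nat (real_complex R)) normc_real ger0_norm.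
rewrite ComplexField.Normc.normcM ComplexField.Normc.normcV nn.
rewrite ler_pdivrMr ?ltr0n//.
apply: le_trans (ler_normcD _ _) _; rewrite ComplexField.Normc.normcM !nn.
apply: le_trans (_ : (a + b)%:R * (normc tau + 1) <= _); last first.
  by rewrite ler_peMr// mulr_ge0// addr_ge0// normc_ge0.
have := normc_ge0 tau; rewrite natrD; have := ler0n R a; have := ler0n R b.
by move=> *; rewrite mulrDl; apply: lerD; rewrite ?ler_wpM2l// ?ler_peMr// ?lerDl ?lerDr.
Qed.

Lemma moderate_growth_pull (R : realType) (m : int) (a b d : nat)
    (f : R[i] -> R[i] -> R[i]) :
  (0 < a)%N -> (0 < d)%N -> moderate_growth m f ->
  moderate_growth (m * (a * d)%N%:Z) (affine_pull a b d f).
Proof.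
move=> a0 d0 [K [r [s [K0 r0 s0 H]]]].
have aR : 0 < a%:R :> R by rewrite ltr0n.
have dR : 0 < d%:R :> R by rewrite ltr0n.
(* [C] comes from $|(a\tau+b)/d|\le 2(a+b)\max(1,|\tau|)$, and [D] from replacing $v$ by $av/d$. *)
pose C : R := ((a + b)%:R * 2) `^ r.
pose D : R := (a%:R / d%:R) `^ (- s).
have C0 : 0 < C by rewrite powR_gt0// mulr_gt0// ltr0n addn_gt0 a0.
have D0 : 0 < D by rewrite powR_gt0// divr_gt0.
exists (K * (2 * C + D)), r, s; split=> //.
  by rewrite mulr_gt0// addr_gt0// mulr_gt0.
move=> tau z tH /=; set v := complex.Im tau; set y := complex.Im z.
have /andP[v0 vx] := uhp_Im_normc tH; have B1 := powR_sum_ge1 (uhp_Im_normc tH) r0 s0.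
have := H _ (a%:R * z) (affine_uhp b a0 d0 tH); rewrite /= -/(affine_pull a b d f tau z).
have -> : complex.Im ((a%:R * tau + b%:R) / d%:R) = a%:R / d%:R * v.
  by rewrite /v; case: (tau) => ? ?; rewrite affine_div.
have -> : complex.Im (a%:R * z) = a%:R * y.
  by rewrite /y; case: (z) => ? ?; rewrite natr_complex.
move=> /lt_le_trans; apply.
have -> : 2 * pi * (m * (a * d)%N%:Z)%:~R * y ^+ 2 / v =
   2 * pi * m%:~R * (a%:R * y) ^+ 2 / (a%:R / d%:R * v).
  by rewrite intrM PoszM intrM; field; rewrite ?gt_eqF.
rewrite ler_wpM2r ?expR_ge0// -(mulrA K) ler_pM2l//.
have q0 : 0 <= a%:R / d%:R :> R by rewrite divr_ge0// ltW.
rewrite (powRM _ q0 (ltW v0)).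
rewrite -/D; set x := normc tau in vx B1 *.
have x0 : 0 <= x by exact: normc_ge0.
have xC : normc ((a%:R * tau + b%:R) / d%:R) `^ r <= C * (1 + x `^ r).
  apply: le_trans (_ : ((a + b)%:R * 2 * Num.max 1 x) `^ r <= _).
    apply: ge0_ler_powR; rewrite ?nnegrE; first exact: ltW.
    - exact: normc_ge0.
    - by rewrite !mulr_ge0// le_max ler01.
    apply: le_trans (normc_affine_le a b tau d0) _; rewrite -mulrA ler_wpM2l//.
    by rewrite -/x; have [?|?] := leP 1 x; lra.
  rewrite powRM//; last by rewrite le_max ler01.
  rewrite ler_pM2l//; have [?|?] := leP 1 x; first by rewrite lerDr.
  by rewrite powR1 lerDl powR_ge0.
apply: le_trans (lerD xC (lexx _)) _.
have := powR_ge0 x r; have := powR_ge0 v (- s); move: B1.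
move: (x `^ r) (v `^ (- s)) => p q B1 q1 p1.
(* The slack of $(2C+D)(p+q)$ over $C(1+p)+Dq$ is nonnegative because $p+q\ge 1$. *)
rewrite -subr_ge0 (_ : _ - _ = C * (p + q - 1) + C * q + D * p); last by ring.
by rewrite !addr_ge0// mulr_ge0 ?subr_ge0// ltW.
Qed.

Lemma period_space_linear (R : realType) (m : int) : linear_closed (@period_space R m).
Proof.
have [h0 hD hZ] := holomorphic_HC_linear R.
have [g0 gD gZ] := moderate_growth_linear R m.
split=> [|f g [hf gf] [hg gg]|c f [hf gf]]; split.
- exact: h0.
- exact: g0.
- exact: hD.
- exact: gD.
- exact: hZ.
- exact: gZ.
Qed.

Lemma period_space_pull (R : realType) (m : int) (a b d : nat)
    (f : R[i] -> R[i] -> R[i]) :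
  (0 < a)%N -> (0 < d)%N -> period_space m f ->
  period_space (m * (a * d)%N%:Z) (affine_pull a b d f).
Proof.
move=> a0 d0 [hf gf]; split; first exact: holomorphic_HC_pull.
exact: moderate_growth_pull.
Qed.

Lemma period_space_ext (R : realType) (m : int) (f g : R[i] -> R[i] -> R[i]) :
  (forall t w, upper_half_plane t -> f t w = g t w) ->
  period_space m g -> period_space m f.
Proof.
move=> fg [hg [K [r [s [K0 r0 s0 H]]]]]; split; first exact: holomorphic_HC_ext hg.
by exists K, r, s; split=> // t z tH; rewrite fg//; exact: H.
Qed.

Lemma Vinfty_linear_closed (R : realType) (k : int) (n : nat)
    (P : (R[i] -> R[i] -> R[i]) -> Prop) (f : nat * nat -> R[i] -> R[i] -> R[i]) :
  (0 < n)%N -> linear_closed P ->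
  (forall p, (0 < n %/ p.1)%N -> (0 < p.1)%N -> (n %/ p.1 * p.1)%N = n ->
     p \in hecke_reps n -> P (affine_pull (n %/ p.1)%N p.2 p.1 (f p))) ->
  P (fun t z => n%:R ^ (k - 1) * \sum_(p <- hecke_reps n)
       p.1%:R ^ (- k) * affine_pull (n %/ p.1)%N p.2 p.1 (f p) t z).
Proof.
move=> n0 Plin HP; have [_ _ PZ] := Plin.
apply: (PZ); apply: linear_closed_sum => // p pn; apply: (PZ).
have := pn; rewrite mem_hecke_reps// => /andP[dn _].
have d0 := dvdn_gt0 n0 dn.
by apply: HP => //; [rewrite divn_gt0// dvdn_leq|rewrite divnK].
Qed.

(** * The Jacobi integral f|V_n^oo *)

Lemma period_function_Vinfty (R : realType) (k m : int) (n : nat)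
    (f : R[i] -> R[i] -> R[i]) (M : 'M[int]_2) (X : 'rV[int]_2) :
  (0 < n)%N -> \det M = 1 ->
  exists (h : nat * nat -> nat * nat) (g : nat * nat -> jacobi_elt R),
    [/\ perm_eq (map h (hecke_reps n)) (hecke_reps n),
        forall p, p \in hecke_reps n -> full_jacobi_group (g p)
      & forall tau z, upper_half_plane tau ->
          period_function k (m * n%:Z) (Vinfty k n f) (int_elt R M X) tau z =
          n%:R ^ (k - 1) * \sum_(p <- hecke_reps n) (h p).1%:R ^ (- k) *
            affine_pull (n %/ (h p).1)%N (h p).2 (h p).1
              (period_function k m f (g p)) tau z].
Proof.
move=> n0 dM; have [h [N [hperm hN]]] := hecke_reps_mulr n0 dM.
(* The adjugate makes [Y p] integral with $Y_pA=nX$, so that moving past the representative $A$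
   gives back [X]. *)
pose Y p := X *m \adj (hecke_mx n (h p)).
exists h, (fun p => int_elt R (N p) (Y p)); split=> // [p /hN[dN _ _]|tau z tH].
  by exists (N p), (Y p).
rewrite /period_function slash1_Vinfty// (VinftyE _ (m%:~R * n%:R))//.
rewrite -mulrBr; congr (_ * _).
(* Reindexing the subtracted sum by [h] pairs the terms that share a representative; each difference
   is then a period function pulled back along it. *)
rewrite -[X in _ - X](perm_big _ hperm) big_map -sumrB !big_seq; apply: eq_bigr => p pn.
have [dN hpn ->] := hN p pn.
have dh : \det (hecke_mx n (h p)) = n%:Z.
  by apply: det_hecke_mx; move: hpn; rewrite mem_hecke_reps// => /andP[].
rewrite -(@int_jslash_comp_right R k m%:~R n (N p) (Y p) (hecke_mx n (h p)) X)//; last first.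
  by rewrite -mulmxA mul_adj_mx dh mul_mx_scalar.
rewrite -int_jslashB -(int_jslash_hecke_mx _ (m%:~R * n%:R))//.
apply: eq_int_jslash; rewrite ?dh// => t w tH'.
by rewrite slash1_int_elt.
Qed.

Lemma jacobi_integral_Vinfty (R : realType) (k m : int) (n : nat)
    (f : R[i] -> R[i] -> R[i]) :
  (0 < n)%N -> jacobi_integral k m f -> jacobi_integral k (m * n%:Z) (Vinfty k n f).
Proof.
move=> n0 [fan fper fP fv].
have VE : Vinfty k n f = fun t z => n%:R ^ (k - 1) * \sum_(p <- hecke_reps n)
    p.1%:R ^ (- k) * affine_pull (n %/ p.1)%N p.2 p.1 f t z.
  by apply/funext => t; apply/funext => z; exact: Vinfty_affine_pull.
split.
- rewrite VE.
  apply: (Vinfty_linear_closed k (f := fun=> f) n0 (real_analytic_HC_linear R)).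
  by move=> p a0 d0 _ _; exact: real_analytic_HC_pull.
- exact: Vinfty_periodic.
- move=> g [M [X [dM ->]]].
  have [h [e [hperm he HE]]] := period_function_Vinfty k m f X n0 dM.
  apply: (period_space_ext HE).
  have [_ _ PZ] := period_space_linear R (m * n%:Z).
  apply: (PZ); apply: linear_closed_sum; first exact: period_space_linear.
  move=> p pn; apply: (PZ).
  have : h p \in hecke_reps n by rewrite -(perm_mem hperm) map_f.
  rewrite (mem_hecke_reps _ n0) => /andP[dn _]; have d0 := dvdn_gt0 n0 dn.
  have a0 : (0 < n %/ (h p).1)%N by rewrite divn_gt0// dvdn_leq.
  by rewrite -[in n%:Z](divnK dn); apply: (period_space_pull _ a0 d0 (fP _ (he p pn))).
- suff: vanishing_at_infinity k (m * n%:Z) (Vinfty k n f) by [].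
  rewrite VE; apply: (Vinfty_linear_closed k (f := fun=> f) n0 (vanishing_linear R k _)).
  move=> p a0 d0 nE _; rewrite -[in n%:Z]nE; exact: vanishing_pull.
Qed.

Theorem theorem2p1 (R : realType) (k m : int) (n : nat) (n_gt0 : (0 < n)%N) :
  (forall f : R[i] -> R[i] -> R[i],
     jacobi_integral k m f ->
     jacobi_integral k (m * n%:Z) (Vinfty k n f)) /\
  (forall f : R[i] -> R[i] -> R[i],
     jacobi_integral k m f -> N1_invariant k m f ->
     forall tau z : R[i], upper_half_plane tau ->
       period_function k (m * n%:Z) (Vinfty k n f) (eltT R) tau z =
       (n%:R `^ (k%:~R / 2 - 1))%:C *
       slash_Vtilde k m n (period_function k m f (eltT R))
         tau ((Num.sqrt n%:R)%:C * z)).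
Proof.
split=> [f|f [_ fper _ _] fN tau z tH]; first exact: jacobi_integral_Vinfty.
exact: period_function_Vinfty_T.
Qed.
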